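(* Let $\mathcal{H}$ be a real Hilbert space and $\sigma>0$. The Gaussian kernel $G_{\sigma}:\mathcal{H}\times\mathcal{H}\to\mathbb{R}$, $G_{\sigma}(x,y)=e^{-\sigma\|x-y\|^{2}}$, is integrally strictly positive definite (ISPD).
   Context: A kernel $K:X\times X\to\mathbb{C}$ on a set $X$ is positive definite if $\sum_{\mu,\nu=1}^{n}c_{\mu}\overline{c_{\nu}}K(x_{\mu},x_{\nu})\ge 0$ for all finitely many distinct points $x_{1},\dots,x_{n}\in X$ and scalars $c_{\mu}\in\mathbb{C}$. Its reproducing kernel Hilbert space $\mathcal{H}_{K}$ is the Hilbert space of functions $F:X\to\mathbb{C}$ that contains $K_{y}:=K(\cdot,y)$ for every $y\in X$, satisfies $\langle F,K_{y}\rangle_{\mathcal{H}_{K}}=F(y)$, and in which $\mathrm{span}\{K_{y}:y\in X\}$ is dense. For a Hausdorff space $X$, $\mathcal{M}(X)$ denotes the set of finite complex-valued Radon measures on $X$, i.e. complex Borel measures $\lambda$ whose total variation $|\lambda|$ is finite and, for every Borel set $E$, satisfies $|\lambda|(E)=\sup\{|\lambda|(K):K\subset E \text{ compact}\}=\inf\{|\lambda|(U):U\supset E\text{ open}\}$. A bounded positive definite kernel $K$ on a Hausdorff space $X$ with $\mathcal{H}_{K}\subset C(X)$ is ISPD if the only $\lambda\in\mathcal{M}(X)$ with $\int_{X}\int_{X}K(x,y)\,d\lambda(x)\,d\overline{\lambda}(y)=0$ is the zero measure. $\mathcal{H}$ carries its norm topology and is not assumed separable. *)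

(* Defs.v *)
From HB Require Import structures.
From mathcomp Require Import all_boot all_order all_algebra.
From mathcomp Require Import all_classical all_reals all_analysis.
From mathcomp Require Import complex.

Set Implicit Arguments.
Unset Strict Implicit.
Unset Printing Implicit Defensive.

Import Order.TTheory GRing.Theory Num.Theory.
Import numFieldNormedType.Exports.

Local Open Scope classical_set_scope.
Local Open Scope ring_scope.

Local Notation Re := (@complex.Re _).
Local Notation Im := (@complex.Im _).

(* [R[i]] carries no topology of its own; as a bundled [numClosedFieldType] it
   gets the topology of the modulus, and normed modules over it make sense. *)
Definition Cplx (R : realType) : numClosedFieldType :=
  Num.ClosedField.clone R[i] _.

(* [`|z|] lives in [Cplx R]; [Cabs z] is the same modulus as an element of [R]. *)
Definition Cabs (R : realType) (z : Cplx R) : R := Re `|z|.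

Section ComplexFacts.
Context {R : realType}.
Implicit Types z w : Cplx R.

Lemma ReD : {morph (Re : Cplx R -> R) : z w / z + w}.
Proof. by case=> ? ? []. Qed.

Lemma ImD : {morph (Im : Cplx R -> R) : z w / z + w}.
Proof. by case=> ? ? []. Qed.

Lemma CabsE z : Cabs z = Num.sqrt (Re z ^+ 2 + Im z ^+ 2).
Proof. by rewrite /Cabs complex.normc_def. Qed.

Lemma normCabs z : `|z| = (Cabs z)%:C%C.
Proof. by rewrite CabsE; exact: complex.normc_def. Qed.

Lemma Re_continuous : continuous (Re : Cplx R -> R).
Proof.
move=> z; apply/(@cvgrPdist_lt _ R _ (nbhs z) (nbhs_filter z)) => e e0.
have e0' : 0 < (e%:C%C : Cplx R) by rewrite ltcR.
apply/nbhs_ballP; exists (e%:C%C) => // w.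
rewrite -ball_normE => zw.
have : `|z - w| < (e%:C%C : Cplx R) by [].
rewrite normCabs ltcR; apply: le_lt_trans.
have -> : Re z - Re w = Re (z - w) by case: (z) (w) => ? ? [].
by rewrite CabsE -sqrtr_sqr ler_wsqrtr// lerDl sqr_ge0.
Qed.

Lemma Im_continuous : continuous (Im : Cplx R -> R).
Proof.
move=> z; apply/(@cvgrPdist_lt _ R _ (nbhs z) (nbhs_filter z)) => e e0.
have e0' : 0 < (e%:C%C : Cplx R) by rewrite ltcR.
apply/nbhs_ballP; exists (e%:C%C) => // w.
rewrite -ball_normE => zw.
have : `|z - w| < (e%:C%C : Cplx R) by [].
rewrite normCabs ltcR; apply: le_lt_trans.
have -> : Im z - Im w = Im (z - w) by case: (z) (w) => ? ? [].
by rewrite CabsE -sqrtr_sqr ler_wsqrtr// lerDr sqr_ge0.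
Qed.

Lemma conjC_continuous : continuous (Num.conj : Cplx R -> Cplx R).
Proof.
move=> z; apply/(@cvgrPdist_lt _ (Cplx R) _ (nbhs z) (nbhs_filter z)) => e e0.
apply/nbhs_ballP; exists e => // w; rewrite -ball_normE => zw.
by rewrite /= -rmorphB norm_conjC.
Qed.

End ComplexFacts.

Section AdditiveImageOfCharge.
Context d (T : measurableType d) (R : realType) (S : numFieldType).
Variables (g : Cplx R -> S) (lam : {charge set T -> \bar (Cplx R)}).
Hypotheses (gD : {morph g : z w / z + w}) (gc : continuous g).

Let gimg (A : set T) : \bar S := (g (fine (lam A)))%:E.

Lemma charge_image_g0 : g 0 = 0.
Proof. by apply: (addrI (g 0)); rewrite -gD !addr0. Qed.

Lemma charge_image0 : gimg set0 = 0%E.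
Proof. by rewrite /gimg charge0 /= charge_image_g0. Qed.

Lemma charge_image_fin A : measurable A -> gimg A \is a fin_num.
Proof. by []. Qed.

Lemma charge_image_sigma_additive : semi_sigma_additive gimg.
Proof.
move=> F mF tF mUF.
have cvgF := @charge_semi_sigma_additive _ _ _ lam F mF tF mUF.
have lamE A : measurable A -> lam A = (fine (lam A))%:E.
  by move=> mA; rewrite fineK// fin_num_measure.
have sumE n : (\sum_(0 <= i < n) lam (F i))%E =
    (\sum_(0 <= i < n) fine (lam (F i)))%:E.
  by rewrite -sumEFin; apply: eq_bigr => i _; exact: lamE.
have gsumE n : (\sum_(0 <= i < n) gimg (F i))%E =
    (g (\sum_(0 <= i < n) fine (lam (F i))))%:E.
  rewrite -[LHS]/(\sum_(0 <= i < n) (g (fine (lam (F i))))%:E)%E sumEFin.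
  by congr EFin; rewrite (big_morph g gD charge_image_g0).
have cvgC : (fun n => \sum_(0 <= i < n) fine (lam (F i)))%R @ \oo -->
    fine (lam (\bigcup_n F n)).
  rewrite (_ : (fun n => _) =
      fine \o (fun n => \sum_(0 <= i < n) lam (F i))%E); last first.
    by apply/funext => n /=; rewrite sumE.
  move=> A nA; apply: (cvgF [set y | A (fine y)]).
  by rewrite (lamE _ mUF).
rewrite (_ : (fun n => _) = fun n =>
    (g (\sum_(0 <= i < n) fine (lam (F i))))%:E); last exact/funext.
have cvgg : (fun n => g (\sum_(0 <= i < n) fine (lam (F i)))) @ \oo -->
    g (fine (lam (\bigcup_n F n))).
  by apply: cvg_comp; [exact: cvgC|exact: gc].
by move=> A nA; exact: (cvgg (fun r => A r%:E) nA).
Qed.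

Lemma charge_image_additive : measure_function.semi_additive gimg.
Proof.
move=> F n mF tF mUF; rewrite /gimg (@charge_semi_additive _ _ _ lam F n mF tF mUF).
have -> : (\sum_(i < n) lam (F i))%E = (\sum_(i < n) fine (lam (F i)))%:E.
  rewrite -sumEFin; apply: eq_bigr => i _.
  by rewrite fineK// fin_num_measure.
by rewrite /= (big_morph g gD charge_image_g0) -sumEFin.
Qed.

End AdditiveImageOfCharge.

Arguments charge_image0 {d T R S g} lam gD.
Arguments charge_image_fin {d T R S} g lam.
Arguments charge_image_sigma_additive {d T R S g} lam gD gc.
Arguments charge_image_additive {d T R S g} lam gD.

Section ComplexMeasures.
Context d (T : measurableType d) (R : realType).

(* A complex measure is a charge with (finite) values in [\bar (Cplx R)]:
   countably additive for the topology of the modulus. *)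
Definition complex_measure := {charge set T -> \bar (Cplx R)}.

Variable lam : complex_measure.

Definition re_part (A : set T) : \bar R := (Re (fine (lam A)))%:E.
HB.instance Definition _ := isCharge.Build _ T R re_part
  (charge_image0 lam ReD) (charge_image_fin Re lam)
  (charge_image_sigma_additive lam ReD Re_continuous).

Definition im_part (A : set T) : \bar R := (Im (fine (lam A)))%:E.
HB.instance Definition _ := isCharge.Build _ T R im_part
  (charge_image0 lam ImD) (charge_image_fin Im lam)
  (charge_image_sigma_additive lam ImD Im_continuous).

Definition conj_measure (A : set T) : \bar (Cplx R) :=
  (Num.conj (fine (lam A)))%:E.

(* countable measurable partitions of [E] *)
Definition total_variation (E : set T) : \bar R :=
  ereal_sup [set (\sum_(0 <= i <oo) (Cabs (fine (lam (F i))))%:E)%E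
    | F in [set F : (set T)^nat |
        [/\ forall i, measurable (F i), trivIset setT F & \bigcup_i F i = E]]].

End ComplexMeasures.

Lemma conjC_morphD (R : realType) :
  {morph (Num.conj : Cplx R -> Cplx R) : z w / z + w}.
Proof. by move=> z w; rewrite rmorphD. Qed.

HB.instance Definition _ d (T : measurableType d) (R : realType)
    (lam : complex_measure T R) :=
  isFinite.Build _ T (Cplx R) (conj_measure lam)
    (charge_image_fin (Num.conj : Cplx R -> Cplx R) lam).
HB.instance Definition _ d (T : measurableType d) (R : realType)
    (lam : complex_measure T R) :=
  isAdditiveCharge.Build _ T (Cplx R) (conj_measure lam)
    (charge_image_additive lam (@conjC_morphD R)).
HB.instance Definition _ d (T : measurableType d) (R : realType)
    (lam : complex_measure T R) :=
  isSemiSigmaAdditive.Build _ T (Cplx R) (conj_measure lam)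
    (charge_image_sigma_additive lam (@conjC_morphD R) conjC_continuous).

Section Integrals.
Context d (T : measurableType d) (R : realType).

Section Real.
Variable nu : {charge set T -> \bar R}.

Definition hahn_pos : set T := sval (cid (Hahn_decomposition nu)).
Definition hahn_neg : set T := sval (cid (svalP (cid (Hahn_decomposition nu)))).

Lemma hahn_pos_neg : hahn_decomposition nu hahn_pos hahn_neg.
Proof. exact: svalP (cid (svalP (cid (Hahn_decomposition nu)))). Qed.

(* The Jordan measures do not depend on the choice of Hahn decomposition. *)
Definition charge_integral (f : T -> R) : R :=
  (\int[jordan_pos hahn_pos_neg]_x f x)%R -
  (\int[jordan_neg hahn_pos_neg]_x f x)%R.

End Real.

Definition complex_integral (lam : complex_measure T R) (f : T -> Cplx R) :
    Cplx R :=
  Complex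
    (charge_integral (re_part lam) (fun x => Re (f x)) -
     charge_integral (im_part lam) (fun x => Im (f x)))
    (charge_integral (re_part lam) (fun x => Im (f x)) +
     charge_integral (im_part lam) (fun x => Re (f x))).

End Integrals.

(* For a topological space [X], the measurable sets of [borel X] are the Borel
   sets of [X]. The library asks for a point of [X]. *)
Notation borel X := (g_sigma_algebraType (@open X)).

Section RadonMeasures.
Context (X : ptopologicalType) (R : realType).

Definition finite_radon (lam : complex_measure (borel X) R) : Prop :=
  (total_variation lam setT < +oo)%E /\
  forall E : set (borel X), measurable E ->
    total_variation lam E = ereal_sup [set total_variation lam K
      | K in [set K : set X | compact K /\ K `<=` E]] /\
    total_variation lam E = ereal_inf [set total_variation lam U
      | U in [set U : set X | open U /\ E `<=` U]].

End RadonMeasures.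

(* An inner product, linear in its first argument, inducing the norm of [V]; a
   Hilbert space is a [completeNormedModType] with such an inner product. *)
Definition induces_norm (F : numFieldType) (V : normedModType F)
    (theta : F -> F) (ip : {dot V for theta}) : Prop :=
  forall v, ip v v = `|v| ^+ 2.

Section Kernels.
Context (R : realType) (X : Type).
Implicit Types K : X -> X -> Cplx R.

Definition bounded_kernel K : Prop :=
  exists M : R, forall x y, Cabs (K x y) <= M.

(* In [Cplx R], [0 <= z] means that [z] is real and nonnegative. *)
Definition positive_definite K : Prop :=
  forall (n : nat) (x : 'I_n -> X) (c : 'I_n -> Cplx R), injective x ->
    0 <= \sum_(i < n) \sum_(j < n) c i * Num.conj (c j) * K (x i) (x j).

Definition linear_span (V : lmodType (Cplx R)) (k : X -> V) : set V :=
  [set v | exists (n : nat) (c : 'I_n -> Cplx R) (y : 'I_n -> X),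
     v = \sum_(i < n) c i *: k (y i)].

(* The injective linear map [ev] presents the Hilbert space [V] as a space of
   functions on [X]; [k y] is the element whose function is [K _ y]. *)
Definition is_rkhs K (V : completeNormedModType (Cplx R))
    (ip : {dot V for Num.conj}) (ev : {linear V -> (X -> Cplx R)}) : Prop :=
  [/\ induces_norm ip, injective ev & exists k : X -> V,
    [/\ forall y, ev (k y) = K ^~ y,
        forall v y, ip v (k y) = ev v y
      & dense (linear_span k)]].

(* The set of functions underlying the reproducing kernel Hilbert space, which
   exists and is unique when [K] is positive definite (Moore-Aronszajn). *)
Definition rkhs K : set (X -> Cplx R) :=
  [set F | exists (V : completeNormedModType (Cplx R))
     (ip : {dot V for Num.conj}) (ev : {linear V -> (X -> Cplx R)}),
     is_rkhs K ip ev /\ range ev F].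

End Kernels.

Record ispd (R : realType) (X : ptopologicalType) (K : X -> X -> Cplx R) :
    Prop := Ispd {
  ispd_hausdorff : hausdorff_space X ;
  ispd_bounded : bounded_kernel K ;
  ispd_positive_definite : positive_definite K ;
  ispd_rkhs_continuous : rkhs K `<=` [set F | continuous F] ;
  ispd_strict : forall lam : complex_measure (borel X) R,
    finite_radon lam ->
    complex_integral (conj_measure lam)
      (fun y => complex_integral lam (fun x => K x y)) = 0 ->
    forall A : set (borel X), measurable A -> lam A = 0%E }.

Definition complex_kernel (R : realType) (X : Type) (K : X -> X -> R) :
    X -> X -> Cplx R :=
  fun x y => (K x y)%:C%C.

Definition gaussian_kernel (R : realType) (H : normedModType R) (sigma : R)
    (x y : H) : R :=
  expR (- (sigma * `|x - y| ^+ 2)).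

(* Main.v *)
(* Given a complex Radon measure lam of zero energy, its real and imaginary
   parts are real signed measures whose Gaussian energies are nonnegative and
   add up to 0, so both vanish.  Approximating a real signed measure nu by point
   masses, the Cauchy-Schwarz inequality for the positive definite kernel shows
   that zero energy forces the potential z |-> \int G(x, z) dnu(x) to be
   identically 0; expanding the square, \int h(x) e^<x,w> dnu(x) = 0 for all w,
   where h(x) = e^(-sigma |x|^2).  The functions f with \int h f dnu = 0 are
   stable under linear combinations and pointwise limits dominated by some
   C e^(c|x|), because h absorbs such a growth.  Starting from the exponentials
   one reaches in this way the linear forms (difference quotients), their cosines
   (power series), and the indicators of a family of sets which is a Boolean
   algebra and separates disjoint compact sets.  Applied to compact subsets
   exhausting the two sides of a Hahn decomposition, this gives nu = 0. *)

Require Import Defs.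
From mathcomp Require Import all_boot all_order all_algebra.
From mathcomp Require Import all_classical all_reals all_analysis.
From mathcomp Require Import measurable_realfun complex ring lra.

Import Order.TTheory GRing.Theory Num.Theory.
Import numFieldNormedType.Exports.
Local Open Scope classical_set_scope.
Local Open Scope ring_scope.
(* [realfun] exports another [total_variation]. *)
Local Notation total_variation := Defs.total_variation.

(** * Positive definiteness of the Gaussian kernel *)

Section RealInnerProduct.
Context {R : realType} {H : normedModType R} (ip : {dot H for idfun}).
Hypothesis ip_norm : induces_norm ip.

Lemma ipC u v : ip u v = ip v u.
Proof. by rewrite hermC expr0 mul1r. Qed.

Lemma ipZl a u v : ip (a *: u) v = a * ip u v.
Proof. by rewrite linearZl_LR. Qed.

Lemma ipZr a u v : ip u (a *: v) = a * ip u v.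
Proof. by rewrite linearZr_LR. Qed.

Lemma ipBl u v w : ip (u - v) w = ip u w - ip v w.
Proof. by rewrite linearBl. Qed.

Lemma ipBr u v w : ip u (v - w) = ip u v - ip u w.
Proof. by rewrite linearBr. Qed.

Lemma ip_CauchySchwarz u v : `|ip u v| <= `|u| * `|v|.
Proof.
have [->|v0] := eqVneq v 0; first by rewrite linear0r !normr0 mulr0.
rewrite -(ler_pXn2r (_ : 0 < 2)%N) ?nnegrE// ?mulr_ge0// exprMn -!ip_norm.
have vv0 : 0 < ip v v by rewrite ip_norm exprn_gt0 ?normr_gt0.
(* [c *: v] is the orthogonal projection of [u] on [v]; the inequality is the positivity of the
   squared norm of the remainder. *)
set c := ip u v / ip v v.
have : 0 <= ip (u - c *: v) (u - c *: v) by rewrite ip_norm exprn_ge0.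
rewrite ipBl !ipBr !ipZl !ipZr (ipC v u) real_normK ?num_real//.
have -> : ip u u - c * ip u v - (c * ip u v - c * (c * ip v v)) =
  (ip u u * ip v v - ip u v ^+ 2) / ip v v by rewrite /c; field; rewrite gt_eqF.
by rewrite pmulr_lge0 ?invr_gt0// subr_ge0.
Qed.

Lemma sqr_normB u v : `|u - v| ^+ 2 = `|u| ^+ 2 + `|v| ^+ 2 - 2 * ip u v.
Proof. by rewrite -!ip_norm ipBl !ipBr (ipC v u); ring. Qed.

End RealInnerProduct.

Definition psd (R : realType) n (A : 'I_n -> 'I_n -> R) :=
  forall d : 'I_n -> R, 0 <= \sum_(i < n) \sum_(j < n) d i * d j * A i j.

Section Psd.
Context {R : realType} {H : normedModType R} (ip : {dot H for idfun}).
Hypothesis ip_norm : induces_norm ip.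

(* Induction on the number of possibly nonzero vectors: the Gram matrix splits
   as a rank-one matrix plus the Gram matrix of the projections orthogonal to
   one of the vectors. *)
Lemma psd_mul_gram n (A : 'I_n -> 'I_n -> R) (x : 'I_n -> H) : psd R n A ->
  psd R n (fun i j => A i j * ip (x i) (x j)).
Proof.
move=> psdA.
suff suf m : forall x : 'I_n -> H, (forall i : 'I_n, (m <= i)%N -> x i = 0) ->
    psd R n (fun i j => A i j * ip (x i) (x j)).
  by apply: (suf n) => i; rewrite leqNgt ltn_ord.
move: x => _; elim: m => [|m IH] x x0 d.
  rewrite big1// => i _; rewrite big1// => j _.
  by rewrite (x0 i)// linear0l !mulr0.
have [nm|mn] := leqP n m.
  by apply: IH => i mi; have := ltn_ord i; rewrite ltnNge (leq_trans nm mi).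
pose v := x (Ordinal mn).
have [v0|v0] := eqVneq v 0.
  apply: IH => i; rewrite leq_eqVlt => /predU1P[mi|]; last exact: x0.
  by rewrite -v0 /v; congr x; apply: val_inj.
have vv0 : 0 < ip v v by rewrite ip_norm exprn_gt0 ?normr_gt0.
pose x' i := x i - (ip (x i) v / ip v v) *: v.
have ipE i j : ip (x i) (x j) =
    ip (x' i) (x' j) + (ip v v)^-1 * (ip (x i) v * ip (x j) v).
  rewrite /x' ipBl !ipBr !ipZl !ipZr (ipC ip v (x j)).
  by field; rewrite gt_eqF.
under eq_bigr do under eq_bigr do rewrite ipE mulrDr mulrDr.
under eq_bigr do rewrite big_split /=.
rewrite big_split /= addr_ge0//.
  apply: IH => i; rewrite leq_eqVlt => /predU1P[mi|/x0 xi0]; last first.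
    by rewrite /x' xi0 linear0l mul0r scale0r subr0.
  have -> : i = Ordinal mn by apply: val_inj.
  by rewrite /x' -/v divff ?gt_eqF// scale1r subrr.
have iv0 : 0 <= (ip v v)^-1 by rewrite invr_ge0 ltW.
have := mulr_ge0 iv0 (psdA (fun i => d i * ip (x i) v)).
rewrite mulr_sumr; congr (_ <= _); apply: eq_bigr => i _.
rewrite mulr_sumr; apply: eq_bigr => j _.
ring.
Qed.

(** Repeated Schur product with the Gram matrix, starting from the all-ones matrix, whose form is
    the square of the sum of the [d i]. *)
Lemma psd_gram_exp n (x : 'I_n -> H) k :
  psd R n (fun i j => ip (x i) (x j) ^+ k).
Proof.
elim: k => [d|k IH].
  under eq_bigr do under eq_bigr do rewrite expr0 mulr1.
  under eq_bigr do rewrite -mulr_sumr.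
  by rewrite -mulr_suml -expr2 sqr_ge0.
have := psd_mul_gram n _ x IH.
by under eq_fun do under eq_fun do rewrite -exprSr.
Qed.

(** The exponential series has nonnegative coefficients in the entrywise powers of the Gram matrix,
    so partial sums have nonnegative forms, and so has the limit. *)
Lemma psd_expR_gram n (x : 'I_n -> H) (s : R) : 0 <= s ->
  psd R n (fun i j => expR (s * ip (x i) (x j))).
Proof.
move=> s0 d.
pose u (k : nat) := \sum_(i < n) \sum_(j < n) d i * d j *
  series (exp_coeff (s * ip (x i) (x j))) k.
have cu : u @ \oo --> \sum_(i < n) \sum_(j < n) d i * d j *
    expR (s * ip (x i) (x j)).
  apply: cvg_big => [|i _]; first exact: add_continuous.
  apply: cvg_big => [|j _]; first exact: add_continuous.
  by apply: cvgMl_tmp; exact: is_cvg_series_exp_coeff.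
rewrite -(cvg_lim _ cu)//; apply: limr_ge; first by apply/cvg_ex; eexists; exact: cu.
apply: nearW => k; rewrite /u.
have -> : \sum_(i < n) \sum_(j < n) d i * d j *
  series (exp_coeff (s * ip (x i) (x j))) k = \sum_(0 <= l < k) (s ^+ l / l`!%:R) *
  \sum_(i < n) \sum_(j < n) d i * d j * ip (x i) (x j) ^+ l.
  under [RHS]eq_bigr do rewrite mulr_sumr.
  rewrite [RHS]exchange_big /=; apply: eq_bigr => i _.
  under [RHS]eq_bigr do rewrite mulr_sumr.
  rewrite [RHS]exchange_big /=; apply: eq_bigr => j _.
  rewrite /series /= mulr_sumr; apply: eq_bigr => l _.
  by rewrite /exp_coeff /= exprMn; ring.
apply: sumr_ge0 => l _; rewrite mulr_ge0//; first by rewrite divr_ge0// exprn_ge0.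
exact: psd_gram_exp.
Qed.

Variable sigma : R.
Hypothesis sigma_gt0 : 0 < sigma.
Local Notation G := (@gaussian_kernel R H sigma).

(** The one-variable factors can be absorbed into the coefficients of a quadratic form, which leaves
    the exponential of a Gram matrix. *)
Lemma gaussian_factor x y : G x y =
  expR (- (sigma * `|x| ^+ 2)) * expR (- (sigma * `|y| ^+ 2)) *
  expR (2 * sigma * ip x y).
Proof.
rewrite /gaussian_kernel (sqr_normB ip)// -!expRD; congr expR; ring.
Qed.

Lemma psd_gaussian n (x : 'I_n -> H) : psd R n (fun i j => G (x i) (x j)).
Proof.
move=> d; have s0 : 0 <= 2 * sigma by rewrite mulr_ge0// ltW.
have := psd_expR_gram n x _ s0 (fun i => d i * expR (- (sigma * `|x i| ^+ 2))).
congr (_ <= _); apply: eq_bigr => i _; apply: eq_bigr => j _.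
rewrite gaussian_factor; ring.
Qed.

Lemma gaussian_sym x y : G x y = G y x.
Proof. by rewrite /gaussian_kernel distrC. Qed.

Lemma gaussian_diag x : G x x = 1.
Proof. by rewrite /gaussian_kernel subrr normr0 expr0n /= mulr0 oppr0 expR0. Qed.

Lemma gaussian_ge0 x y : 0 <= G x y.
Proof. exact: expR_ge0. Qed.

Lemma gaussian_le1 x y : G x y <= 1.
Proof. by rewrite -expR0 ler_expR oppr_le0 mulr_ge0 ?(ltW sigma_gt0)// exprn_ge0. Qed.

(* Cauchy-Schwarz in the reproducing kernel Hilbert space, where [G _ z] is a
   unit vector. *)
Lemma gaussian_CauchySchwarz n (x : 'I_n -> H) (c : 'I_n -> R) z :
  (\sum_(i < n) c i * G (x i) z) ^+ 2 <=
  \sum_(i < n) \sum_(j < n) c i * c j * G (x i) (x j).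
Proof.
set S := \sum_(i < n) c i * G (x i) z.
(* Positivity is applied to the points [x] together with [z], with coefficient [- S] at [z]. Since
   [G z z = 1], the form equals the right-hand side plus [S ^+ 2 - 2 * S ^+ 2]. *)
pose x' (i : 'I_n.+1) := if unlift ord0 i is Some j then x j else z.
pose c' (i : 'I_n.+1) := if unlift ord0 i is Some j then c j else - S.
have := psd_gaussian _ x' c'.
rewrite big_ord_recl.
under [X in _ <= _ + X]eq_bigr do rewrite big_ord_recl.
rewrite big_split /= big_ord_recl /= /x' /c' unlift_none gaussian_diag.
under eq_bigr do rewrite liftK.
under [X in _ <= _ + (X + _)]eq_bigr do rewrite liftK.
under [X in _ <= _ + (_ + X)]eq_bigr do under eq_bigr do rewrite !liftK.
have -> : \sum_(i < n) - S * c i * G z (x i) = - S * S.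
  transitivity (- S * \sum_(i < n) c i * G (x i) z); last by [].
  rewrite mulr_sumr; apply: eq_bigr => i _.
  by rewrite -mulrA (gaussian_sym z).
have -> : \sum_(i < n) c i * - S * G (x i) z = - S * S.
  transitivity (- S * \sum_(i < n) c i * G (x i) z); last by [].
  rewrite mulr_sumr; apply: eq_bigr => i _; ring.
move=> h; rewrite -subr_ge0; move: h; congr (_ <= _); ring.
Qed.

(** Cauchy-Schwarz for the difference of the unit vectors [G _ u] and [G _ v], whose squared norm
    [2 - 2 * G u v] is bounded through [1 + t <= expR t]. *)
Lemma gaussian_lipschitz u v z : `|G u z - G v z| ^+ 2 <= 2 * sigma * `|u - v| ^+ 2.
Proof.
have := gaussian_CauchySchwarz 2 (fun i => if i == ord0 then u else v)
  (fun i => if i == ord0 then 1 else -1) z.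
rewrite !big_ord_recl !big_ord0 /= !gaussian_diag (gaussian_sym v u).
rewrite real_normK ?num_real// !addr0 !mul1r !mulN1r => /le_trans; apply.
have : 1 - sigma * `|u - v| ^+ 2 <= G u v by exact: expR_ge1Dx.
lra.
Qed.

End Psd.

(** * Integration against signed measures *)

(** A class stable under sums and products, all of whose members are integrable for every finite
    measure. *)
Definition bmeas d (T : measurableType d) (R : realType) (f : T -> R) :=
  measurable_fun setT f /\ exists M, forall x, `|f x| <= M.

Section BoundedMeasurable.
Context d (T : measurableType d) (R : realType).
Local Notation bmeas := (@bmeas d T R).
Implicit Types f g : T -> R.

Lemma bmeasD {f g} : bmeas f -> bmeas g -> bmeas (fun x => f x + g x).
Proof.
move=> [mf [M fM]] [mg [N gN]]; split; first exact: measurable_funD.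
by exists (M + N) => x; rewrite (le_trans (ler_normD _ _))// lerD.
Qed.

Lemma bmeasM {f g} : bmeas f -> bmeas g -> bmeas (fun x => f x * g x).
Proof.
move=> [mf [M fM]] [mg [N gN]]; split; first exact: measurable_funM.
by exists (M * N) => x; rewrite normrM ler_pM.
Qed.

Lemma bmeas_cst (c : R) : bmeas (fun=> c).
Proof. by split; [exact: measurable_cst|exists `|c|]. Qed.

Lemma bmeasZ (c : R) {f} : bmeas f -> bmeas (fun x => c * f x).
Proof. by apply: bmeasM; exact: bmeas_cst. Qed.

Lemma bmeasB {f g} : bmeas f -> bmeas g -> bmeas (fun x => f x - g x).
Proof.
move=> bf bg; have := bmeasD bf (bmeasZ (-1) bg).
by under eq_fun do rewrite mulN1r.
Qed.

Lemma bmeas_indic (A : set T) : measurable A -> bmeas (\1_A).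
Proof.
move=> mA; split; first exact: measurable_indic.
by exists 1 => x; rewrite indicE; case: (_ \in _); rewrite ?normr1 ?normr0.
Qed.

Lemma bmeas_sum n (f : 'I_n -> T -> R) : (forall i, bmeas (f i)) ->
  bmeas (fun x => \sum_(i < n) f i x).
Proof.
elim: n f => [|n IH] f bf.
  by under eq_fun do rewrite big_ord0; exact: bmeas_cst.
under eq_fun do rewrite big_ord_recl.
by apply: bmeasD => //; exact: IH.
Qed.

Lemma bmeas_integrable (m : {finite_measure set T -> \bar R}) {f} : bmeas f ->
  m.-integrable setT (EFin \o f).
Proof.
move=> [mf [M fM]]; apply: measurable_bounded_integrable => //.
  by rewrite ltey_eq fin_num_measure.
exists M; split; first by rewrite num_real.
by move=> N MN x _ /=; rewrite (le_trans (fM x))// ltW.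
Qed.

End BoundedMeasurable.

(** The two measures need not be a Jordan pair, so that different representations of one signed
    measure can be compared. *)
Definition sint d (T : measurableType d) (R : realType)
    (m1 m2 : {finite_measure set T -> \bar R}) (f : T -> R) : R :=
  \int[m1]_x f x - \int[m2]_x f x.

Section SignedIntegral.
Context d (T : measurableType d) (R : realType).
Local Notation bmeas := (@bmeas d T R).

Section TwoMeasures.
Variables m1 m2 : {finite_measure set T -> \bar R}.
Implicit Types f g : T -> R.
Local Notation J := (@sint d T R m1 m2).

Lemma sintD {f g} : bmeas f -> bmeas g -> J (fun x => f x + g x) = J f + J g.
Proof.
move=> bf bg; rewrite /sint !RintegralD//; try exact: bmeas_integrable.
ring.
Qed.

Lemma sintZ (c : R) {f} : bmeas f -> J (fun x => c * f x) = c * J f.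
Proof.
move=> bf; rewrite /sint !RintegralZl//; try exact: bmeas_integrable.
ring.
Qed.

Lemma sintB {f g} : bmeas f -> bmeas g -> J (fun x => f x - g x) = J f - J g.
Proof.
move=> bf bg; rewrite /sint !RintegralB//; try exact: bmeas_integrable.
ring.
Qed.

Lemma sint_sum n (f : 'I_n -> T -> R) : (forall i, bmeas (f i)) ->
  J (fun x => \sum_(i < n) f i x) = \sum_(i < n) J (f i).
Proof.
elim: n f => [|n IH] f bf.
  rewrite big_ord0; under eq_fun do rewrite big_ord0.
  have := @sintZ 0 (fun=> 0) (bmeas_cst _ _ _ 0).
  by under eq_fun do rewrite mul0r; rewrite mul0r.
rewrite big_ord_recl; under eq_fun do rewrite big_ord_recl.
by rewrite sintD//; [rewrite IH|exact: bmeas_sum].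
Qed.

(** The absolute value of [f] is at most [c] plus [e] times the indicator of the complement of [A].
    For quadrature, [A] is a compact set where [f] is small and whose complement has little mass. *)
Lemma le_normr_sint (A : set T) f (c e : R) : measurable A -> bmeas f ->
  0 <= c -> 0 <= e ->
  (forall x, A x -> `|f x| <= c) -> (forall x, `|f x| <= e) ->
  `|J f| <= c * (fine (m1 setT) + fine (m2 setT)) +
    e * (fine (m1 (~` A)) + fine (m2 (~` A))).
Proof.
move=> mA bf c0 e0 fc fe.
have bnd (m : {finite_measure set T -> \bar R}) :
    `|\int[m]_x f x| <= c * fine (m setT) + e * fine (m (~` A)).
  apply: le_trans (le_normr_Rintegral _ _) _ => //; first exact: bmeas_integrable.
  have bA := bmeas_indic _ _ _ _ (measurableC mA).
  apply: (@le_trans _ _ (\int[m]_x (c + e * \1_(~` A) x))).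
    apply: le_Rintegral => //.
    - apply: bmeas_integrable; case: bf => mf [M fM]; split.
        exact: measurableT_comp.
      by exists M => x; rewrite normr_id.
    - by apply: bmeas_integrable; apply: bmeasD; [exact: bmeas_cst|exact: bmeasZ].
    - move=> x _; rewrite indicE in_setC.
      by have [/set_mem/fc|_] /= := boolP (x \in A);
        rewrite ?mulr0 ?addr0// mulr1 (le_trans (fe x))// lerDr.
  rewrite RintegralD//; last 2 first.
  - exact/bmeas_integrable/bmeas_cst.
  - exact/bmeas_integrable/bmeasZ.
  rewrite Rintegral_cst// RintegralZl//; last exact/bmeas_integrable.
  by rewrite /Rintegral integral_indic ?setIT//; exact: measurableC.
rewrite (le_trans (ler_normB _ _))// (le_trans (lerD (bnd m1) (bnd m2)))//.
by rewrite le_eqVlt; apply/orP; left; apply/eqP; ring.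
Qed.

Lemma sint_cvg (f : nat -> T -> R) (g : T -> R) (M : R) :
  (forall n, measurable_fun setT (f n)) ->
  (forall n x, `|f n x| <= M) -> (forall x, f n x @[n --> \oo] --> g x) ->
  J (f n) @[n --> \oo] --> J g.
Proof.
move=> mf fM fg.
have mg : measurable_fun setT g by exact: measurable_fun_cvg (fun x _ => fg x).
have cvgm (m : {finite_measure set T -> \bar R}) :
    \int[m]_x f n x @[n --> \oo] --> \int[m]_x g x.
  have ig : m.-integrable setT (EFin \o g).
    apply: bmeas_integrable; split => //; exists M => x.
    have cn : `|f n x| @[n --> \oo] --> `|g x| by exact: cvg_norm.
    rewrite -(cvg_lim _ cn)//; apply: limr_le; first by apply/cvg_ex; eexists; exact: cn.
    exact: nearW.
  have cE : {ae m, forall x, setT x -> (EFin \o f n) x @[n --> \oo] --> (EFin \o g) x}.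
    by apply: aeW => x _; apply: cvg_EFin; [exact: nearW|exact: fg].
  have bE : {ae m, forall x n, setT x -> (`|(EFin \o f n) x| <= M%:E)%E}.
    by apply: aeW => x n _; rewrite lee_fin.
  have [_ _ h] := @dominated_convergence _ _ _ m setT measurableT
    (fun n => EFin \o f n) (EFin \o g) (fun=> M%:E)
    (fun n => (measurable_EFinP _ _).2 (mf n)) ((measurable_EFinP _ _).2 mg) cE
    (bmeas_integrable _ _ _ m (bmeas_cst _ _ _ M)) bE.
  have/fine_cvgP[] // : (\int[m]_x (EFin \o f n) x)%E @[n --> \oo] -->
     (fine (\int[m]_x (EFin \o g) x)%E)%:E.
  by rewrite fineK//; exact: integrable_fin_num.
by apply: cvgB; exact: cvgm.
Qed.

End TwoMeasures.

(** The hypothesis says [m1 - m2 = m3 - m4] without subtracting extended reals; [f] is integrated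
    against the two sums of measures. *)
Lemma eq_sint (m1 m2 m3 m4 : {finite_measure set T -> \bar R}) (f : T -> R) :
  (forall A, measurable A -> (m1 A + m4 A = m3 A + m2 A)%E) -> bmeas f ->
  sint _ _ _ m1 m2 f = sint _ _ _ m3 m4 f.
Proof.
move=> mE bf.
have addE (m m' : {finite_measure set T -> \bar R}) :
    \int[m]_x f x + \int[m']_x f x = \int[measure_add m m']_x f x.
  rewrite /Rintegral integral_measure_add//; try exact: bmeas_integrable.
    have fin n := integrable_fin_num measurableT (bmeas_integrable _ _ _ n bf).
    exact/esym/fineD/fin/fin.
have : \int[m1]_x f x + \int[m4]_x f x = \int[m3]_x f x + \int[m2]_x f x.
  rewrite !addE /Rintegral; congr fine; apply: eq_measure_integral => A mA _.
  transitivity (m1 A + m4 A)%E; first exact: measure_addE.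
  by rewrite mE//; exact/esym/measure_addE.
rewrite /sint; lra.
Qed.

End SignedIntegral.

(** * Total variation and inner regularity of complex measures *)

Section TotalVariation.
Context d (T : measurableType d) (R : realType).
Variable lam : complex_measure T R.

Local Notation partition_of E := [set F : (set T)^nat |
  [/\ forall i, measurable (F i), trivIset setT F & \bigcup_i F i = E]].
Local Notation mass F :=
  (\sum_(0 <= i <oo) (Cabs (fine (lam (F i))))%:E)%E.

Lemma Cabs_ge0 (z : Cplx R) : 0 <= Cabs z.
Proof. by rewrite CabsE sqrtr_ge0. Qed.

Lemma mass_ge0 (F : (set T)^nat) : (0 <= mass F)%E.
Proof. by apply: nneseries_ge0 => n _ _; rewrite lee_fin Cabs_ge0. Qed.

Lemma le_mass_total_variation E (F : (set T)^nat) : partition_of E F ->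
  (mass F <= total_variation lam E)%E.
Proof. by move=> EF; apply: ereal_sup_ubound; exists F. Qed.

(** Partitions are indexed by [nat], so [F] is shifted by one to place [A] at index 0. Extending
    partitions in this way bounds the variation of larger sets from below. *)
Lemma partition_cons (A E : set T) (F : (set T)^nat) : measurable A ->
  A `&` E = set0 -> partition_of E F ->
  exists G : (set T)^nat, partition_of (A `|` E) G /\
    mass G = ((Cabs (fine (lam A)))%:E + mass F)%E.
Proof.
move=> mA AE0 [mF tF FE].
pose G n := if n is m.+1 then F m else A; exists G; split; first split.
- by case.
- move=> i j _ _ [x []]; case: i j => [|i] [|j] //= ax bx.
  + by exfalso; have : set0 x by rewrite -AE0; split=> //; rewrite -FE; exists j.
  + by exfalso; have : set0 x by rewrite -AE0; split=> //; rewrite -FE; exists i.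
  + by congr S; apply: tF => //; exists x.
- apply/seteqP; split => x /=.
    case=> -[|n] _ /= Gx; first by left.
    by right; rewrite -FE; exists n.
  by case=> [Ax|]; [exists 0%N|rewrite -FE => -[n _ Fx]; exists n.+1].
have g0 (H : (set T)^nat) k : (0 <= (Cabs (fine (lam (H k))))%:E)%E.
  by rewrite lee_fin Cabs_ge0.
rewrite (@nneseries_recl _ xpredT (fun i => (Cabs (fine (lam (G i))))%:E))//=.
congr (_ + _)%E; rewrite -nneseries_addn//.
by under eq_eseriesr do rewrite addn1.
Qed.

(** A partition [F] of [K] with mass above [total_variation lam E - e] extends by [A] and the rest
    of [E] to a partition of [E], which leaves room for at most [e] in [A]. *)
Lemma total_variation_setD_le (E K : set T) (e : R) : 0 < e ->
  measurable E -> K `<=` E -> total_variation lam E \is a fin_num ->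
  (total_variation lam E - e%:E < total_variation lam K)%E ->
  forall A, measurable A -> A `<=` E `\` K -> Cabs (fine (lam A)) <= e.
Proof.
move=> e0 mE KE fE /ereal_sup_gt[_ [F [mF tF FK] <-] ltF] A mA AEK.
have mK : measurable K by rewrite -FK; exact: bigcupT_measurable.
have [||G [pG GE]] := @partition_cons (E `\` K `\` A) K F _ _ (And3 mF tF FK).
- by apply: measurableD => //; exact: measurableD.
- by apply/seteqP; split => x //= [[[]]].
have [|G' [pG' GE']] := @partition_cons A _ G mA _ pG.
  by apply/seteqP; split => x //= -[Ax [[]//|/((AEK _ Ax).2)]].
have EE : A `|` (E `\` K `\` A `|` K) = E.
  apply/seteqP; split => x /=.
    by case=> [/AEK[]//|[[[]]|/KE]].
  move=> Ex; have [Ax|nAx] := pselect (A x); first by left.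
  by right; have [Kx|nKx] := pselect (K x); [right|left].
rewrite EE in pG'.
have := le_mass_total_variation _ _ pG'; rewrite GE' GE => leE.
have {}leE : ((Cabs (fine (lam A)))%:E + mass F <= total_variation lam E)%E.
  apply: le_trans leE; rewrite leeD2l// leeDr// lee_fin; exact: Cabs_ge0.
move: leE ltF; have := mass_ge0 F.
rewrite -(fineK fE); case: (mass F) => [r| |]//=.
by rewrite -EFinB -EFinD !lee_fin lte_fin; lra.
Qed.

Lemma total_variation_setT (E : set T) : measurable E ->
  (total_variation lam E <= total_variation lam setT)%E.
Proof.
move=> mE; apply: ge_ereal_sup => _ [F pF <-].
have [|G [pG GE]] := @partition_cons (~` E) E F (measurableC mE) _ pF.
  by rewrite setICl.
rewrite setUC setUv in pG.
by rewrite (le_trans _ (le_mass_total_variation _ _ pG))// GE leeDr// lee_fin Cabs_ge0.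
Qed.

Lemma total_variation_ge0 (E : set T) : measurable E ->
  (0 <= total_variation lam E)%E.
Proof.
(* The partition into [E] and empty sets shows that the supremum is not over an empty family, where
   it would be [-oo]. *)
move=> mE; pose F (n : nat) : set T := if n is 0%N then E else set0.
apply: (le_trans (mass_ge0 F)); apply: le_mass_total_variation; split.
- by case=> [//|n]; exact: measurable0.
- by move=> [|i] [|j] _ _ [x []].
- apply/seteqP; split => x /=; first by case=> -[].
  by exists 0%N.
Qed.

End TotalVariation.

(** Phrased with values on subsets instead of a variation: this form passes from a complex measure
    to its real and imaginary parts, and it controls both Jordan measures through [jordan_small]. *)
Definition inner_regular (X : ptopologicalType) (R : realType)
    (nu : {charge set (borel X) -> \bar R}) : Prop :=
  forall (E : set (borel X)) (e : R), measurable E -> 0 < e ->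
  exists K : set X, [/\ compact K, K `<=` E &
    forall A : set (borel X), measurable A -> A `<=` E `\` K ->
      `|fine (nu A)| <= e].

Section RadonParts.
Context (X : ptopologicalType) (R : realType).
Variable lam : complex_measure (borel X) R.
Hypothesis radon_lam : finite_radon lam.

Lemma finite_radon_compact (E : set (borel X)) (e : R) : measurable E -> 0 < e ->
  exists K : set X, [/\ compact K, K `<=` E &
    forall A : set (borel X), measurable A -> A `<=` E `\` K ->
      Cabs (fine (lam A)) <= e].
Proof.
move=> mE e0; have [fT /(_ _ mE)[EK _]] := radon_lam.
have fE : total_variation lam E \is a fin_num.
  rewrite ge0_fin_numE; last exact: total_variation_ge0.
  exact: le_lt_trans (total_variation_setT _ _ _ lam _ mE) fT.
(* Since the variation is finite, subtracting [e] strictly lowers it, and some compact [K] exceeds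
   the lowered value. *)
have : (total_variation lam E - e%:E < total_variation lam E)%E.
  by rewrite lteBlDr// lteDl// lte_fin.
rewrite {2}EK => /ereal_sup_gt[_ [K [cK KE] <-] ltK].
by exists K; split=> //; exact: total_variation_setD_le ltK.
Qed.

Lemma inner_regular_re_part : inner_regular X R (re_part lam).
Proof.
move=> E e mE /(finite_radon_compact _ _ mE)[K [cK KE lamK]].
exists K; split=> // A mA AEK; apply: le_trans (lamK A mA AEK).
by rewrite CabsE -sqrtr_sqr ler_wsqrtr// lerDl sqr_ge0.
Qed.

Lemma inner_regular_im_part : inner_regular X R (im_part lam).
Proof.
move=> E e mE /(finite_radon_compact _ _ mE)[K [cK KE lamK]].
exists K; split=> // A mA AEK; apply: le_trans (lamK A mA AEK).
by rewrite CabsE -sqrtr_sqr ler_wsqrtr// lerDr sqr_ge0.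
Qed.

End RadonParts.

(** * Integrals against real and complex charges *)

Section ChargeIntegral.
Context d (T : measurableType d) (R : realType).
Implicit Types nu : {charge set T -> \bar R}.

Local Notation jpos nu := (jordan_pos (hahn_pos_neg nu)).
Local Notation jneg nu := (jordan_neg (hahn_pos_neg nu)).

Lemma jpos_fin nu (A : set T) : measurable A -> jpos nu A \is a fin_num.
Proof. exact: (@fin_num_measure _ _ _ (jpos nu : {finite_measure set T -> \bar R})). Qed.

Lemma jneg_fin nu (A : set T) : measurable A -> jneg nu A \is a fin_num.
Proof. exact: (@fin_num_measure _ _ _ (jneg nu : {finite_measure set T -> \bar R})). Qed.

Lemma sube_eq_swap (a b c e : \bar R) : (a - b = c - e)%E ->
  a \is a fin_num -> b \is a fin_num -> c \is a fin_num -> e \is a fin_num ->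
  (a + e = c + b)%E.
Proof.
by case: a b c e => [a| |] [b| |] [c| |] [e| |]//= -[ace] _ _ _ _; congr EFin; lra.
Qed.

Lemma charge_integralE nu f : charge_integral nu f =
  sint _ _ _ (jpos nu) (jneg nu) f.
Proof. by []. Qed.

Lemma jordan_decomp_sub nu (A : set T) : measurable A ->
  nu A = (jpos nu A - jneg nu A)%E.
Proof. by move=> mA; rewrite (jordan_decomp (hahn_pos_neg nu) mA) /cadd /= cscaleN1. Qed.

(** The Hahn sets of [nu] and [nu'] are chosen separately, so only the differences of their Jordan
    measures are compared. *)
Lemma eq_charge_integral nu nu' f : (forall A, measurable A -> nu A = nu' A) ->
  bmeas _ _ _ f -> charge_integral nu f = charge_integral nu' f.
Proof.
move=> nuE bf; rewrite !charge_integralE; apply: eq_sint => // A mA.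
have := nuE A mA; rewrite (jordan_decomp_sub nu A mA) (jordan_decomp_sub nu' A mA).
by move=> /sube_eq_swap; apply; rewrite ?jpos_fin ?jneg_fin.
Qed.

Lemma charge_integral_opp nu nu' f : (forall A, measurable A -> nu A = (- nu' A)%E) ->
  bmeas _ _ _ f -> charge_integral nu f = - charge_integral nu' f.
Proof.
move=> nuE bf; rewrite !charge_integralE.
transitivity (sint _ _ _ (jneg nu') (jpos nu') f); last by rewrite /sint opprB.
apply: eq_sint => // A mA.
have := nuE A mA; rewrite (jordan_decomp_sub nu A mA) (jordan_decomp_sub nu' A mA).
rewrite oppeB; last by rewrite fin_num_adde_defr// jpos_fin.
by rewrite [X in _ = X]addeC => /sube_eq_swap; apply; rewrite ?jpos_fin ?jneg_fin.
Qed.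

Lemma charge_integral0 nu : charge_integral nu (fun=> 0) = 0.
Proof.
have := sintZ _ _ _ (jpos nu) (jneg nu) 0 (bmeas_cst _ _ _ 0).
by rewrite !mul0r.
Qed.

Lemma complex_integral_re_im (lam : complex_measure T R) (f g : T -> R) :
  complex_integral lam (fun x => Complex (f x) (g x)) =
  Complex (charge_integral (re_part lam) f - charge_integral (im_part lam) g)
    (charge_integral (re_part lam) g + charge_integral (im_part lam) f).
Proof. by []. Qed.

(** As [K] is real, the inner integral has real part [F (re_part lam)] and imaginary part
    [F (im_part lam)], and conjugation flips the sign of [im_part lam]. The energies thus add up in
    the real part of the double integral; the cross terms lie in its imaginary part. *)
Lemma complex_integral_conj_double (lam : complex_measure T R) (K : T -> T -> R) :
  let F nu y := charge_integral nu (K ^~ y) in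
  bmeas _ _ _ (F (re_part lam)) -> bmeas _ _ _ (F (im_part lam)) ->
  complex_integral (conj_measure lam)
    (fun y => complex_integral lam (fun x => complex_kernel K x y)) = 0 ->
  charge_integral (re_part lam) (F (re_part lam)) +
  charge_integral (im_part lam) (F (im_part lam)) = 0.
Proof.
move=> F bre bim.
under eq_fun do rewrite complex_integral_re_im.
under eq_fun do rewrite !charge_integral0 subr0 add0r.
rewrite complex_integral_re_im => -[+ _].
have -> : charge_integral (re_part (conj_measure lam)) (F (re_part lam)) =
    charge_integral (re_part lam) (F (re_part lam)).
  apply: eq_charge_integral => // A mA.
  by rewrite /= /re_part /= /conj_measure /=; case: (fine _).
have -> : charge_integral (im_part (conj_measure lam)) (F (im_part lam)) =
    - charge_integral (im_part lam) (F (im_part lam)).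
  apply: charge_integral_opp => // A mA.
  by rewrite /= /im_part /= /conj_measure /=; case: (fine _).
by rewrite opprK.
Qed.

(** The Jordan measures of [B] are the values of [nu] and [- nu] on its traces on the two Hahn
    sets. *)
Lemma jordan_small nu (B : set T) (e : R) : measurable B ->
  (forall A, measurable A -> A `<=` B -> `|fine (nu A)| <= e) ->
  fine (jpos nu B) + fine (jneg nu B) <= 2 * e.
Proof.
move=> mB nuB.
have [[mP _] [mN _] _ _] := hahn_pos_neg nu.
have posE : jpos nu B = nu (B `&` hahn_pos nu).
  by rewrite jordan_posE cjordan_posE /crestr0 mem_set.
have negE : jneg nu B = (- nu (B `&` hahn_neg nu))%E.
  by rewrite jordan_negE cjordan_negE /crestr0 mem_set.
rewrite posE negE fineN.
have := nuB (B `&` hahn_pos nu) (measurableI _ _ mB mP) (@subIsetl _ _ _).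
have := nuB (B `&` hahn_neg nu) (measurableI _ _ mB mN) (@subIsetl _ _ _).
rewrite !ler_norml => /andP[? ?] /andP[? ?]; lra.
Qed.

End ChargeIntegral.

(** * Borel and Lipschitz functions, quadrature by point masses *)

Section BorelFunctions.
Context (X : ptopologicalType) (R : realType).

Lemma borel_open (U : set X) : open U -> measurable (U : set (borel X)).
Proof. by move=> oU; apply: sub_sigma_algebra. Qed.

Lemma continuous_borel_measurable (f : X -> R) : continuous f ->
  measurable_fun (setT : set (borel X)) f.
Proof.
move=> /continuousP cf.
apply: (measurability _ (RGenOpens.measurableE R)).
move=> _ [_ [a [b ->] <-]]; rewrite setTI; apply: borel_open.
exact/cf/interval_open.
Qed.

End BorelFunctions.

Lemma lipschitz_continuous (R : realType) (H : normedModType R) (f : H -> R) (L : R) :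
  (forall u v, `|f u - f v| <= L * `|u - v|) -> continuous f.
Proof.
move=> fL x; apply/cvgrPdist_le => e e0; near=> y.
rewrite (le_trans (fL x y))//.
(* [L] may be zero or negative, so a positive constant above it is used for the division. *)
have L1 : 0 < `|L| + 1 by rewrite ltr_pwDr.
rewrite (@le_trans _ _ ((`|L| + 1) * `|x - y|))//.
  by rewrite ler_wpM2r// (le_trans (ler_norm L))// lerDl.
rewrite -ler_pdivlMl// mulrC; near: y.
by apply: cvgr_dist_le; [exact: cvg_id|rewrite divr_gt0].
Unshelve. all: by end_near. Qed.

Section Quadrature.
Context (R : realType) (H : normedModType R).
Local Notation BH := (borel H).

Lemma step_sum n (A : 'I_n -> set H) (a : 'I_n -> R) k u :
  trivIset setT A -> A k u -> \sum_(i < n) a i * \1_(A i) u = a k.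
Proof.
move=> tA Aku; rewrite (bigD1 k)//= indicE mem_set// mulr1 big1 ?addr0// => i ik.
rewrite indicE memNset ?mulr0// => Aiu.
by move/eqP: ik; apply; apply: tA => //; exists u.
Qed.

Lemma compact_partition (K : set H) (dlt : R) : compact K -> 0 < dlt ->
  exists n (x : 'I_n -> H) (A : 'I_n -> set H),
  [/\ forall i, measurable (A i : set BH), trivIset setT A,
      forall i u, A i u -> `|u - x i| <= dlt & K `<=` \bigcup_i A i].
Proof.
move=> cK d0; move: cK; rewrite compact_cover.
move=> /(_ H setT (fun x => ball x dlt)) [||D _ KD].
- by move=> x _; exact: ball_open.
- by move=> x _; exists x => //; exact: ballxx.
pose s := finmap.enum_fset D.
(* Padding the finite cover by empty sets gives a sequence on [nat], which [seqDU] makes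
   disjoint. *)
pose B k : set H := if (k < size s)%N then ball (nth 0 s k) dlt else set0.
exists (size s), (fun i => nth 0 s i), (fun i => seqDU B i); split.
- move=> i; apply: (@measurableD _ BH).
    by rewrite /B ltn_ord; apply: borel_open; exact: ball_open.
  apply: (@bigsetU_measurable _ BH) => k _; rewrite /B; case: ifP => _.
    by apply: borel_open; exact: ball_open.
  exact: (@measurable0 _ BH).
- move=> i j _ _ h; apply: val_inj; apply: (trivIset_seqDU B) => //.
- move=> i u [+ _]; rewrite /B ltn_ord -ball_normE /= distrC; exact: ltW.
- move=> u /KD[y /= yD yu].
  have ys : y \in s by [].
  have : (\bigcup_k B k) u.
    by exists (index y s) => //; rewrite /B index_mem ys nth_index.
  rewrite (seqDU_bigcup_eq B) => -[k _ Bk].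
  have ks : (k < size s)%N.
    by move: Bk => -[+ _]; rewrite /B; case: ifP.
  by exists (Ordinal ks).
Qed.

Variable nu : {charge set BH -> \bar R}.
Hypothesis nu_reg : inner_regular H R nu.

Local Notation m1 := (jordan_pos (hahn_pos_neg nu)).
Local Notation m2 := (jordan_neg (hahn_pos_neg nu)).

(** The total variation norm of [nu], read off its Jordan measures. *)
Definition mass_bound : R := fine (m1 setT) + fine (m2 setT).

Lemma mass_bound_ge0 : 0 <= mass_bound.
Proof. by rewrite addr_ge0// fine_ge0// measure_ge0. Qed.

Lemma lipschitz_bmeas (g : H -> R) (L B : R) :
  (forall u v, `|g u - g v| <= L * `|u - v|) -> (forall u, `|g u| <= B) ->
  bmeas _ BH _ g.
Proof.
move=> gL gB; split; last by exists B.
by apply: continuous_borel_measurable; exact: lipschitz_continuous gL.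
Qed.

(** The weights are the charges of small disjoint cells covering a compact set that carries most of
    the mass. Nodes and weights are chosen before [g], since one rule has to serve all kernel
    functions and the potential at once. *)
Lemma quadrature (L B e : R) : 0 <= L -> 0 <= B -> 0 < e ->
  exists n (x : 'I_n -> H) (c : 'I_n -> R),
  (\sum_(i < n) `|c i| <= mass_bound) /\
  forall g : H -> R, (forall u v, `|g u - g v| <= L * `|u - v|) ->
    (forall u, `|g u| <= B) ->
    `|charge_integral nu g - \sum_(i < n) c i * g (x i)| <= e.
Proof.
move=> L0 B0 e0; have M0 := mass_bound_ge0.
(* The error is at most [L * dlt * mass_bound] from the oscillation on [K] plus [2 * B * (2 * r)]
   from outside [K]; each is made at most [e / 2]. The added 1 keeps the denominators positive. *)
pose dlt := e / 2 / (L * mass_bound + 1); pose r := e / 8 / (B + 1).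
have d0 : 0 < dlt by rewrite !divr_gt0// ltr_wpDl// mulr_ge0.
have r0 : 0 < r by rewrite !divr_gt0// ltr_wpDl.
have [K [cK _ Kr]] := nu_reg setT r measurableT r0.
have [n [x [A [mA tA Ax KA]]]] := compact_partition K dlt cK d0.
have mK : measurable (K : set BH).
  rewrite -[K]setCK; apply: (@measurableC _ BH); apply: borel_open.
  by rewrite openC; apply: compact_closed => //; exact: norm_hausdorff.
have Kc : fine (m1 (~` K)) + fine (m2 (~` K)) <= 2 * r.
  apply: jordan_small; first exact: measurableC.
  by move=> C mC CK; apply: Kr => // u /CK.
have bA i : bmeas _ BH _ (\1_(A i) : _ -> R) by exact: bmeas_indic.
have step_cases u : (exists k, A k u) \/ (forall i, ~ A i u).
  by apply: contrapT => /not_orP[/forallNP h]; apply.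
have step_out (a : 'I_n -> R) u : (forall i, ~ A i u) ->
    \sum_(i < n) a i * \1_(A i) u = 0.
  by move=> nA; rewrite big1// => i _; rewrite indicE memNset// mulr0.
have bstep (a : 'I_n -> R) : bmeas _ BH _ (fun u => \sum_(i < n) a i * \1_(A i) u).
  by apply: bmeas_sum => i; exact: bmeasZ.
have Jstep (a : 'I_n -> R) :
    charge_integral nu (fun u => \sum_(i < n) a i * \1_(A i) u) =
    \sum_(i < n) charge_integral nu (\1_(A i)) * a i.
  rewrite charge_integralE sint_sum; last by move=> i; exact: bmeasZ.
  by apply: eq_bigr => i _; rewrite sintZ// mulrC.
exists n, x, (fun i => charge_integral nu (\1_(A i))); split.
  (* The sum of absolute values is the integral of the step function whose values are the signs of
     the weights; it is bounded by 1 because the cells are disjoint. *)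
  rewrite (eq_bigr (fun i => charge_integral nu (\1_(A i)) *
      Num.sg (charge_integral nu (\1_(A i))))); last first.
    by move=> i _; rewrite mulrC -normrEsg.
  rewrite -Jstep (le_trans (ler_norm _))//.
  have sg1 u : `|\sum_(i < n) Num.sg (charge_integral nu (\1_(A i))) *
      \1_(A i) u| <= 1.
    have [[k Ak]|nA] := step_cases u; last by rewrite step_out// normr0.
    by rewrite (step_sum _ _ _ k)// normr_sg; case: (_ != _).
  rewrite charge_integralE.
  rewrite (le_trans (le_normr_sint _ _ _ m1 m2 setT _ 1 1 _ _ _ _ _ _))//.
  by rewrite setCT !measure0 /= addr0 mulr0 addr0 mul1r.
move=> g gL gB; have bg := lipschitz_bmeas _ _ _ gL gB.
rewrite -(Jstep (fun i => g (x i))) !charge_integralE -sintB//.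
have LM : 0 <= L * dlt by rewrite mulr_ge0// ltW.
apply: (le_trans (le_normr_sint _ _ _ m1 m2 K _ (L * dlt) (2 * B) mK _ LM _ _ _)).
- exact: bmeasB.
- by rewrite mulr_ge0.
- move=> u Ku; have [k _ Aku] := KA u Ku.
  rewrite (step_sum _ _ (fun i => g (x i)) k)// (le_trans (gL _ _))//.
  by rewrite ler_wpM2l// Ax.
- move=> u; rewrite mulr_natl mulr2n; have [[k Aku]|nA] := step_cases u.
    by rewrite (step_sum _ _ (fun i => g (x i)) k)// (le_trans (ler_normB _ _))// lerD.
  by rewrite step_out// subr0 (le_trans (gB u))// lerDl.
have LMe : L * dlt * mass_bound <= e / 2.
  have -> : L * dlt * mass_bound = e / 2 * (L * mass_bound / (L * mass_bound + 1)).
    rewrite /dlt; field; rewrite gt_eqF// ltr_wpDl// mulr_ge0//.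
  rewrite ler_piMr//; first by rewrite divr_ge0// ltW.
  by rewrite ler_pdivrMr ?mul1r ?lerDl// ltr_wpDl// mulr_ge0.
have Bre : 2 * B * (fine (m1 (~` K)) + fine (m2 (~` K))) <= e / 2.
  rewrite (le_trans (ler_wpM2l _ Kc)) ?mulr_ge0//.
  have -> : 2 * B * (2 * r) = e / 2 * (B / (B + 1)).
    by rewrite /r; field; rewrite gt_eqF// ltr_wpDl.
  rewrite ler_piMr//; first by rewrite divr_ge0// ltW.
  by rewrite ler_pdivrMr ?mul1r ?lerDl// ltr_wpDl.
rewrite -/mass_bound; lra.
Qed.

End Quadrature.

(** * Energy and potential *)

Section Energy.
Context {R : realType} {H : normedModType R} (ip : {dot H for idfun}).
Hypothesis ip_norm : induces_norm ip.
Variable sigma : R.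
Hypothesis sigma_gt0 : 0 < sigma.
Local Notation G := (@gaussian_kernel R H sigma).

Lemma gaussian_lipschitz_sqrt u v z :
  `|G u z - G v z| <= Num.sqrt (2 * sigma) * `|u - v|.
Proof.
rewrite -(ler_pXn2r (_ : 0 < 2)%N) ?nnegrE ?mulr_ge0 ?sqrtr_ge0//.
rewrite exprMn sqr_sqrtr ?mulr_ge0 ?(ltW sigma_gt0)//.
exact: gaussian_lipschitz ip ip_norm _ sigma_gt0 _ _ _.
Qed.

Lemma gaussian_norm_le1 u z : `|G u z| <= 1.
Proof. by rewrite ger0_norm ?gaussian_ge0// gaussian_le1. Qed.

Lemma gaussian_bmeas z : bmeas _ (borel H) _ (G^~ z).
Proof.
exact: lipschitz_bmeas (fun u v => gaussian_lipschitz_sqrt u v z)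
  (fun u => gaussian_norm_le1 u z).
Qed.

Variable nu : {charge set (borel H) -> \bar R}.

Definition potential (z : H) : R := charge_integral nu (G^~ z).

Lemma le_normr_charge_integral (g : H -> R) (c : R) : bmeas _ (borel H) _ g ->
  0 <= c -> (forall u, `|g u| <= c) ->
  `|charge_integral nu g| <= c * mass_bound R H nu.
Proof.
move=> bg c0 gc; rewrite charge_integralE.
apply: (le_trans (le_normr_sint _ _ _ _ _ setT _ c c _ _ _ _ _ _)) => //.
by rewrite setCT !measure0 /= addr0 mulr0 addr0.
Qed.

Lemma potential_le z : `|potential z| <= mass_bound R H nu.
Proof.
rewrite -[leRHS]mul1r le_normr_charge_integral//; first exact: gaussian_bmeas.
by move=> u; exact: gaussian_norm_le1.
Qed.

Lemma potential_lipschitz u v : `|potential u - potential v| <=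
  Num.sqrt (2 * sigma) * mass_bound R H nu * `|u - v|.
Proof.
rewrite /potential !charge_integralE -sintB; try exact: gaussian_bmeas.
rewrite mulrAC -charge_integralE le_normr_charge_integral//.
- by apply: bmeasB; exact: gaussian_bmeas.
- by move=> z; rewrite !(gaussian_sym _ z) gaussian_lipschitz_sqrt.
Qed.

Lemma potential_bmeas : bmeas _ (borel H) _ potential.
Proof. exact: lipschitz_bmeas potential_lipschitz potential_le. Qed.

Definition energy : R := charge_integral nu potential.

Hypothesis nu_reg : inner_regular H R nu.

(** [S] and [s] are the energy and the potential of a sum of point masses approximating [nu].
    Letting [e] tend to 0 transfers positivity and Cauchy-Schwarz to [nu]. *)
Lemma energy_approx (e : R) : 0 < e -> exists S : R,
  [/\ 0 <= S, `|energy - S| <= e &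
      forall z, exists2 s, `|potential z - s| <= e & s ^+ 2 <= S].
Proof.
move=> e0; set M := mass_bound R H nu; have M0 : 0 <= M := mass_bound_ge0 _ _ _.
have M1 : 0 < 1 + M by rewrite ltr_pwDl.
set L := Num.sqrt (2 * sigma); have L0 : 0 <= L by exact: sqrtr_ge0.
have e0' : 0 < e / (1 + M) by rewrite divr_gt0.
have LM0 : 0 <= L * (1 + M) by rewrite mulr_ge0// ltW.
(* These constants cover both the kernel functions ([L] and 1) and the potential ([L * M] and [M]).
   The tolerance is spent once on the potential and once under weights of total at most [M], which
   makes [e]. *)
have [n [x [c [cM quad]]]] := quadrature _ _ nu nu_reg _ _ _ LM0 (ltW M1) e0'.
have quadG z : `|potential z - \sum_(i < n) c i * G (x i) z| <= e / (1 + M).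
  apply: quad => [u v|u].
    apply: le_trans (gaussian_lipschitz_sqrt u v z) _.
    by rewrite ler_wpM2r// ler_peMr// lerDl.
  by apply: le_trans (gaussian_norm_le1 u z) _; rewrite lerDl.
exists (\sum_(i < n) \sum_(j < n) c i * c j * G (x i) (x j)); split.
- exact: psd_gaussian ip ip_norm _ sigma_gt0 _ _ _.
- have quadF : `|energy - \sum_(i < n) c i * potential (x i)| <= e / (1 + M).
    apply: quad => [u v|u].
      apply: le_trans (potential_lipschitz u v) _.
      by rewrite ler_wpM2r// ler_wpM2l// lerDr.
    by apply: le_trans (potential_le u) _; rewrite lerDr.
  have -> : energy - \sum_(i < n) \sum_(j < n) c i * c j * G (x i) (x j) =
    (energy - \sum_(i < n) c i * potential (x i)) +
    \sum_(i < n) c i * (potential (x i) - \sum_(j < n) c j * G (x j) (x i)).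
    rewrite [X in _ = _ + X](eq_bigr _ (fun i _ => mulrBr _ _ _)).
    rewrite sumrB addrA subrK; congr (_ - _); apply: eq_bigr => i _.
    by rewrite mulr_sumr; apply: eq_bigr => j _; rewrite mulrA (gaussian_sym _ (x j)).
  have -> : e = e / (1 + M) + M * (e / (1 + M)) by field; rewrite gt_eqF.
  rewrite (le_trans (ler_normD _ _))// lerD// (le_trans (ler_norm_sum _ _ _))//.
  apply: (@le_trans _ _ (\sum_(i < n) `|c i| * (e / (1 + M)))).
    by apply: ler_sum => i _; rewrite normrM ler_wpM2l.
  by rewrite -mulr_suml ler_wpM2r// ltW.
- move=> z; exists (\sum_(i < n) c i * G (x i) z).
    rewrite (le_trans (quadG z))// ler_piMr ?(ltW e0)// invf_le1//.
    by rewrite lerDl.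
  exact: gaussian_CauchySchwarz ip ip_norm _ sigma_gt0 _ _ _ _.
Qed.

Lemma energy_ge0 : 0 <= energy.
Proof.
rewrite leNgt; apply/negP => E0.
have [|S [S0 + _]] := energy_approx (- energy / 2); first by rewrite divr_gt0// oppr_gt0.
by rewrite ler_norml => /andP[]; lra.
Qed.

Lemma energy_eq0 : energy = 0 -> forall z, potential z = 0.
Proof.
move=> E0 z; apply/eqP; rewrite -normr_le0 leNgt; apply/negP => F0.
set f := `|potential z| in F0.
(* The first bound keeps [s] at least [f / 2] in absolute value, hence
   [f ^+ 2 / 4 <= s ^+ 2 <= S <= e], against [e <= f ^+ 2 / 8]. *)
pose e := Num.min (f / 2) (f ^+ 2 / 8).
have e0 : 0 < e by rewrite lt_min !divr_gt0// exprn_gt0.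
have [S [S0 + /(_ z)[s Fs sS]]] := energy_approx e e0.
rewrite E0 sub0r normrN ger0_norm// => Se.
have ef : e <= f / 2 by rewrite ge_min lexx.
have ef2 : e <= f ^+ 2 / 8 by rewrite ge_min lexx orbT.
have sf : f / 2 <= `|s|.
  by have := ler_distD 0 (potential z) s; rewrite !subr0 sub0r normrN -/f => ?;
  have := lerB_dist (potential z) s; rewrite -/f; lra.
have : (f / 2) ^+ 2 <= `|s| ^+ 2 by rewrite ler_pXn2r// ?nnegrE// divr_ge0// ltW.
rewrite real_normK ?num_real//.
have : 0 < f ^+ 2 by rewrite exprn_gt0.
nra.
Qed.

End Energy.

(** * Functions orthogonal to a signed measure of zero potential *)

(** Being inductive, the class allows limits of limits to any depth, and its properties follow by
    induction. The growth bound is of a kind that is stable under products and absorbed by the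
    Gaussian weight. *)
Inductive exp_closure (R : realType) (H : normedModType R)
    (ip : {dot H for idfun}) : (H -> R) -> Prop :=
| exp_closure_expR w : exp_closure R H ip (fun x => expR (ip x w))
| exp_closure_lin a f g : exp_closure R H ip f -> exp_closure R H ip g ->
    exp_closure R H ip (fun x => a * f x + g x)
| exp_closure_lim (f : nat -> H -> R) g C c : (forall n, exp_closure R H ip (f n)) ->
    (forall n x, `|f n x| <= C * expR (c * `|x|)) ->
    (forall x, f n x @[n --> \oo] --> g x) -> exp_closure R H ip g.

Section ExpClosure.
Context {R : realType} {H : normedModType R} (ip : {dot H for idfun}).
Hypothesis ip_norm : induces_norm ip.
Local Notation ec := (exp_closure R H ip).

Lemma ec_ext f g : f =1 g -> ec f -> ec g.
Proof. by move=> /funext ->. Qed.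

Lemma ecZ a f : ec f -> ec (fun x => a * f x).
Proof.
move=> ef; have e0 := exp_closure_lin _ _ _ (-1) _ _ ef ef.
apply: ec_ext (exp_closure_lin _ _ _ a _ _ ef e0) => x.
by rewrite mulN1r addNr addr0.
Qed.

Lemma ecD f g : ec f -> ec g -> ec (fun x => f x + g x).
Proof.
move=> ef eg; apply: ec_ext (exp_closure_lin _ _ _ 1 _ _ ef eg) => x.
by rewrite mul1r.
Qed.

Lemma ecB f g : ec f -> ec g -> ec (fun x => f x - g x).
Proof.
move=> ef eg; apply: ec_ext (exp_closure_lin _ _ _ (-1) _ _ eg ef) => x.
by rewrite mulN1r addrC.
Qed.

Lemma ec_cst a : ec (fun=> a).
Proof.
apply: ec_ext (ecZ a _ (exp_closure_expR _ _ ip 0)) => x.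
by rewrite linear0r expR0 mulr1.
Qed.

(** Supplies the domination needed to multiply a limit by a fixed member, and the boundedness of
    weighted members. *)
Lemma ec_growth f : ec f -> exists C c, forall x, `|f x| <= C * expR (c * `|x|).
Proof.
elim=> [w|a {}f g _ [C [c fC]] _ [D [d gD]]|F g C c _ _ FC Fg].
- exists 1, `|w| => x; rewrite ger0_norm ?expR_ge0// mul1r ler_expR.
  by rewrite (le_trans (ler_norm _))// mulrC ip_CauchySchwarz.
- have pos (C' c' : R) (h : H -> R) : (forall x, `|h x| <= C' * expR (c' * `|x|)) -> 0 <= C'.
    move=> /(_ 0) /(le_trans (normr_ge0 _)).
    by rewrite pmulr_lge0// expR_gt0.
  have C0 := pos _ _ _ fC; have D0 := pos _ _ _ gD.
  exists (`|a| * C + D), (`|c| + `|d|) => x.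
  rewrite (le_trans (ler_normD _ _))// normrM mulrDl -mulrA lerD//.
    rewrite ler_wpM2l// (le_trans (fC x))// ler_wpM2l// ler_expR ler_wpM2r//.
    by rewrite (le_trans (ler_norm c))// lerDl.
  rewrite (le_trans (gD x))// ler_wpM2l// ler_expR ler_wpM2r//.
  by rewrite (le_trans (ler_norm d))// lerDr.
- exists C, c => x; have Fgn : `|F n x| @[n --> \oo] --> `|g x|.
    exact: cvg_norm.
  rewrite -(cvg_lim _ Fgn)//; apply: limr_le.
    by apply/cvg_ex; eexists; exact: Fgn.
  exact: nearW.
Qed.

(** Induction on [g] for an exponential [f], starting from products of exponentials; then induction
    on [f]. Limits go through because the other factor grows at most exponentially. *)
Lemma ecM f g : ec f -> ec g -> ec (fun x => f x * g x).
Proof.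
move=> ef; elim: ef g => [w|a {}f f' _ IHf _ IHf'|F {}f C c _ IHF FC Ff] g eg.
- elim: eg => [v|a {}g g' _ IHg _ IHg'|F g' C c _ IHF FC Fg].
  + apply: ec_ext (exp_closure_expR _ _ ip (w + v)) => x.
    by rewrite linearDr expRD.
  + apply: ec_ext (exp_closure_lin _ _ _ a _ _ IHg IHg') => x; ring.
  + apply: (exp_closure_lim _ _ _ _ _ C (`|w| + c) IHF) => [n x|x].
      rewrite normrM mulrC mulrDl expRD mulrA [leRHS]mulrAC ler_pM//.
      rewrite ger0_norm ?expR_ge0// ler_expR.
      by rewrite (le_trans (ler_norm _))// mulrC ip_CauchySchwarz.
    by apply: cvgM => //; exact: cvg_cst.
- apply: ec_ext (exp_closure_lin _ _ _ a _ _ (IHf g eg) (IHf' g eg)) => x; ring.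
- have [D [d gD]] := ec_growth g eg.
  apply: (exp_closure_lim _ _ _ _ _ (C * D) (c + d) (fun n => IHF n g eg)) => [n x|x].
    by rewrite normrM mulrDl expRD mulrACA ler_pM.
  by apply: cvgM => //; exact: cvg_cst.
Qed.

Lemma ecX n f : ec f -> ec (fun x => f x ^+ n).
Proof.
move=> ef; elim: n => [|n IH]; first exact: ec_ext (ec_cst 1).
by apply: ec_ext (ecM _ _ ef IH) => x; rewrite exprS.
Qed.

Lemma ec_sum n (f : nat -> H -> R) : (forall i, ec (f i)) ->
  ec (fun x => \sum_(0 <= i < n) f i x).
Proof.
move=> ef; elim: n => [|n IH].
  by apply: ec_ext (ec_cst 0) => x; rewrite big_geq.
by apply: ec_ext (ecD _ _ IH (ef n)) => x; rewrite big_nat_recr.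
Qed.

Lemma ec_bounded_lim (f : nat -> H -> R) g C : (forall n, ec (f n)) ->
  (forall n x, `|f n x| <= C) -> (forall x, f n x @[n --> \oo] --> g x) -> ec g.
Proof.
move=> ef fC; apply: (exp_closure_lim _ _ _ f g C 0) => // n x.
by rewrite mul0r expR0 mulr1.
Qed.

Lemma expR_sub1_bounds (y : R) : y <= expR y - 1 <= y * expR y.
Proof.
have := expR_ge1Dx y; have := expR_ge1Dx (- y).
rewrite expRN => h1 h2; apply/andP; split; first lra.
have := ler_wpM2r (expR_ge0 y) h1.
by rewrite mulVf ?gt_eqF ?expR_gt0//; lra.
Qed.

(** The quotients [k * (expR (ip x w / k) - 1)] are squeezed between [ip x w] and
    [ip x w * expR (ip x w / k)], which also dominates them by an exponential of twice the absolute
    value of [ip x w]. *)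
Lemma ec_ip w : ec (fun x => ip x w).
Proof.
pose k (n : nat) : R := n.+1%:R.
have k0 n : 0 < k n by exact: ltr0Sn.
have ksE x n : expR (ip x ((k n)^-1 *: w)) = expR (ip x w / k n).
  by rewrite ipZr mulrC.
have kb x n : ip x w <= k n * (expR (ip x w / k n) - 1) <=
    ip x w * expR (ip x w / k n).
  have /andP[h1 h2] := expR_sub1_bounds (ip x w / k n).
  by rewrite -ler_pdivrMl// mulrC h1 /= -ler_pdivlMl// mulrA (mulrC (k n)^-1) h2.
apply: (exp_closure_lim _ _ _
  (fun n x => k n * (expR (ip x ((k n)^-1 *: w)) - 1)) _ 1 (2 * `|w|)).
- by move=> n; apply: ecZ; apply: ecB; [exact: exp_closure_expR|exact: ec_cst].
- move=> n x; rewrite ksE mul1r.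
  have s2 : 2 * `|ip x w| <= 2 * `|w| * `|x|.
    by rewrite -mulrA ler_wpM2l// mulrC ip_CauchySchwarz.
  apply: le_trans (_ : expR (2 * `|ip x w|) <= _); last by rewrite ler_expR.
  rewrite mulr_natl mulr2n expRD.
  have s1 : `|ip x w| <= expR `|ip x w|.
    by rewrite (le_trans _ (expR_ge1Dx _))// lerDr.
  have e1 : 1 <= expR `|ip x w| by rewrite -expR0 ler_expR.
  have /andP[h1 h2] := kb x n; rewrite ler_norml; apply/andP; split.
    apply: le_trans h1; rewrite lerNl (le_trans (ler_norm _))// normrN.
    by rewrite (le_trans s1)// ler_peMr// expR_ge0.
  rewrite (le_trans h2)// (le_trans (ler_norm _))// normrM.
  rewrite ler_pM// ger0_norm ?expR_ge0// ler_expR.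
  rewrite (le_trans (ler_norm _))// normrM ler_piMr// ger0_norm ?invr_ge0 ?(ltW (k0 n))//.
  by rewrite invf_le1// /k ler1n.
- move=> x; under eq_fun do rewrite ksE.
  apply: (@squeeze_cvgr _ _ _ _ (fun=> ip x w) (fun n => ip x w * expR (ip x w / k n))).
  + by apply: nearW => n; exact: kb.
  + exact: cvg_cst.
  + rewrite -[X in _ --> X]mulr1 -expR0; apply: cvgM; first exact: cvg_cst.
    apply: continuous_cvg; first exact: continuous_expR.
    rewrite -[X in _ --> X](mulr0 (ip x w)); apply: cvgM; first exact: cvg_cst.
    exact: cvg_harmonic.
Qed.

Lemma series_exp_coeff_le (y : R) n : 0 <= y ->
  \sum_(0 <= i < n) exp_coeff y i <= expR y.
Proof.
move=> y0; rewrite /expR; apply: (nondecreasing_cvgn_le _ _ n).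
  by apply: nondecreasing_series => i _ _; exact: exp_coeff_ge0.
exact: is_cvg_series_exp_coeff.
Qed.

(** The partial sums of the cosine series are dominated by the exponential of the absolute value of
    [f]; affine growth of [f] makes this an admissible bound. *)
Lemma ec_cos f (a c : R) : ec f -> (forall x, `|f x| <= a + c * `|x|) ->
  ec (fun x => cos (f x)).
Proof.
move=> ef fac.
apply: (exp_closure_lim _ _ _ (fun n x => series (cos_coeff (f x)) n) _ (expR a) c).
- move=> n; apply: ec_sum => i.
  apply: ec_ext (ecZ ((~~ odd i)%:R * (-1) ^+ i./2 / i`!%:R) _ (ecX i f ef)) => x.
  by rewrite cos_coeffE.
- move=> n x; rewrite -expRD; apply: le_trans (_ : expR `|f x| <= _).
    apply: le_trans (series_exp_coeff_le _ n (normr_ge0 _)).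
    rewrite (le_trans (ler_norm_sum _ _ _))//; apply: ler_sum => i _.
    rewrite cos_coeffE !normrM normfV normrX normrN normr1 expr1n mulr1 !normrX.
    rewrite !normr_nat /exp_coeff /= [leRHS]mulrC ler_wpM2r// ?exprn_ge0//.
    by case: odd; rewrite ?mul0r ?mul1r.
  by rewrite ler_expR.
- by move=> x; rewrite unlock; exact: is_cvg_series_cos_coeff.
Qed.

(* [abs_approx t n] increases to [`|t|] when [`|t| <= 1]: it is the iteration
   p |-> p + (t^2 - p^2) / 2 started at 0, whose fixed point is [`|t|]. *)
Fixpoint abs_approx (t : R) n : R :=
  if n is m.+1 then abs_approx t m + (t ^+ 2 - abs_approx t m ^+ 2) / 2 else 0.

(** With [p] the current iterate, one step multiplies the error by [1 - (|t| + p) / 2], which lies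
    between 0 and [1 - |t| / 2] because [0 <= p <= |t| <= 1]. *)
Lemma abs_approx_bounds t n : `|t| <= 1 ->
  0 <= `|t| - abs_approx t n <= `|t| * (1 - `|t| / 2) ^+ n /\ 0 <= abs_approx t n.
Proof.
move=> t1; elim: n => [|n [/andP[h1 h2] h3]].
  by rewrite /= subr0 expr0 mulr1 lexx normr_ge0.
have t0 := normr_ge0 t.
have tE : t ^+ 2 = `|t| ^+ 2 by rewrite real_normK ?num_real.
have stepE : `|t| - abs_approx t n.+1 =
    (`|t| - abs_approx t n) * (1 - (`|t| + abs_approx t n) / 2).
  by rewrite /= tE; field.
split; last first.
  rewrite /= addr_ge0// divr_ge0// tE subr_ge0 ler_pXn2r// ?nnegrE//; lra.
rewrite stepE mulr_ge0//=; last lra.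
rewrite exprSr mulrA ler_pM//; lra.
Qed.

Lemma cvg_abs_approx t : `|t| <= 1 -> abs_approx t n @[n --> \oo] --> `|t|.
Proof.
move=> t1.
suff : `|t| - abs_approx t n @[n --> \oo] --> (0 : R).
  move=> h; have : `|t| - (`|t| - abs_approx t n) @[n --> \oo] --> `|t| - 0.
    by apply: cvgB => //; exact: cvg_cst.
  by rewrite subr0; under eq_fun do rewrite opprB addrC subrK.
apply: (@squeeze_cvgr _ _ _ _ (fun=> 0) (fun n => `|t| * (1 - `|t| / 2) ^+ n)).
- by apply: nearW => n; have [] := abs_approx_bounds t n t1.
- exact: cvg_cst.
- have [->|t0] := eqVneq t 0.
    by under eq_fun do rewrite normr0 mul0r; exact: cvg_cst.
  rewrite -[X in _ --> X](mulr0 `|t|); apply: cvgM; first exact: cvg_cst.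
  apply: cvg_expr; have : 0 < `|t| by rewrite normr_gt0.
  by move=> ?; rewrite ger0_norm; lra.
Qed.

Lemma ec_abs f : ec f -> (forall x, `|f x| <= 1) -> ec (fun x => `|f x|).
Proof.
move=> ef f1; apply: (ec_bounded_lim (fun n x => abs_approx (f x) n) _ 1).
- elim=> [|n IH] /=; first exact: ec_cst.
  apply: ecD => //; apply: ec_ext (ecZ 2^-1 _ (ecB _ _ (ecX 2 _ ef) (ecX 2 _ IH))) => x.
  by rewrite mulrC.
- move=> n x; have [/andP[h1 _] h2] := abs_approx_bounds _ n (f1 x).
  by rewrite ger0_norm//; have := f1 x; lra.
- by move=> x; exact: cvg_abs_approx.
Qed.

(** The positive part [g] of [f] takes values between 0 and 1, so [1 - (1 - g) ^+ n] tends to 1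
    where [g] is positive and is 0 elsewhere in the limit. *)
Lemma ec_indic_gt0 f : ec f -> (forall x, `|f x| <= 1) ->
  ec (\1_[set x | 0 < f x]).
Proof.
move=> ef f1; pose g x := (f x + `|f x|) / 2.
have eg : ec g.
  apply: ec_ext (ecZ 2^-1 _ (ecD _ _ ef (ec_abs _ ef f1))) => x.
  by rewrite mulrC.
have g01 x : 0 <= 1 - g x <= 1.
  have := f1 x; have := ler_norm (f x); have := ler_norm (- f x); rewrite normrN /g; lra.
apply: (ec_bounded_lim (fun n x => 1 - (1 - g x) ^+ n) _ 1).
- move=> n; apply: ecB; first exact: ec_cst.
  by apply: ecX; apply: ecB => //; exact: ec_cst.
- move=> n x; have /andP[h1 h2] := g01 x.
  have := exprn_ge0 n h1; have := exprn_ile1 n h1 h2.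
  by move=> ? ?; rewrite ger0_norm; lra.
- move=> x; rewrite indicE; have [fx|fx] := ltP 0 (f x).
    rewrite mem_set// -[X in _ --> X]subr0; apply: cvgB; first exact: cvg_cst.
    apply: cvg_expr; rewrite ger0_norm; last by have /andP[] := g01 x.
    by rewrite /g ger0_norm ?(ltW fx)//; lra.
  rewrite memNset /=; last by apply/negP; rewrite -leNgt.
  rewrite /g ler0_norm// subrr mul0r.
  by under eq_fun do rewrite subr0 expr1n subrr; exact: cvg_cst.
Qed.

Lemma ec_indicC S : ec (\1_S) -> ec (\1_(~` S)).
Proof.
move=> eS; apply: ec_ext (ecB _ _ (ec_cst 1) eS) => x.
by rewrite !indicE in_setC; case: (x \in S); rewrite ?subrr ?subr0.
Qed.

Lemma ec_indicI S S' : ec (\1_S) -> ec (\1_S') -> ec (\1_(S `&` S')).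
Proof.
move=> eS eS'; apply: ec_ext (ecM _ _ eS eS') => x.
by rewrite !indicE in_setI -mulnb natrM.
Qed.

Lemma ec_indicU S S' : ec (\1_S) -> ec (\1_S') -> ec (\1_(S `|` S')).
Proof.
move=> eS eS'; rewrite -[S `|` S']setCK setCU.
by apply: ec_indicC; apply: ec_indicI; exact: ec_indicC.
Qed.

Lemma ec_separates_points (x y : H) : x != y -> exists S : set H,
  [/\ ec (\1_S), nbhs x S & nbhs y (~` S)].
Proof.
(* [v] is scaled so that the affine form [g] is 0 at [x] and [pi] at [y]; its cosine is 1 and -1
   there, and bounded as [ec_indic_gt0] requires. *)
rewrite eq_sym -subr_eq0 => yx0; pose v := (pi / ip (y - x) (y - x)) *: (y - x).
pose g u := ip u v - ip x v.
have gL u u' : `|g u - g u'| <= `|v| * `|u - u'|.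
  have -> : g u - g u' = ip (u - u') v by rewrite ipBl /g; ring.
  by rewrite mulrC ip_CauchySchwarz.
have gx : g x = 0 by rewrite /g subrr.
have gy : g y = pi.
  rewrite /g -ipBl ipZr divfK// ip_norm expf_neq0// normr_eq0//.
have cg : continuous (fun u => cos (g u)).
  move=> u; apply: continuous_comp; last exact: continuous_cos.
  exact: lipschitz_continuous gL _.
have eg : ec g by apply: ecB; [exact: ec_ip|exact: ec_cst].
have ecg : ec (fun u => cos (g u)).
  apply: (ec_cos _ (`|x| * `|v|) `|v|) => // u.
  rewrite (le_trans (ler_normB _ _))// addrC lerD ?ip_CauchySchwarz//.
  by rewrite mulrC ip_CauchySchwarz.
exists [set u | 0 < cos (g u)]; split.
- by apply: ec_indic_gt0 => // u; rewrite ler_norml cos_geN1 cos_le1.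
- apply: (cg x [set t | 0 < t]); apply: open_nbhs_nbhs; split.
    exact: open_gt.
  by rewrite /= gx cos0 ltr01.
- have : nbhs y [set u | cos (g u) < 0].
    apply: (cg y [set t | t < 0]); apply: open_nbhs_nbhs; split.
      exact: open_lt.
    by rewrite /= gy cospi oppr_lt0.
  by apply: filterS => u /= gu0; apply/negP; rewrite -leNgt ltW.
Qed.

End ExpClosure.

(* Complements of the members of [P] form a filter, so this is the filter
   formulation of compactness. *)
Lemma compact_ind (X : topologicalType) (P : set X -> Prop) (C : set X) :
  compact C -> P set0 -> (forall A B, P A -> P B -> P (A `|` B)) ->
  (forall A B, A `<=` B -> P B -> P A) ->
  (forall x, C x -> exists2 U, nbhs x U & P U) -> P C.
Proof.
move=> /compact_near_coveringP cC P0 PU PS loc.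
pose F : set_system X := fun A => P (~` A).
have FF : Filter F.
  split; first by rewrite /F setCT.
    by move=> A B; rewrite /F setCI; exact: PU.
  by move=> A B AB; apply: PS; exact: subsetC.
(* For the relation [i <> x], the near-covering property says that the complement of [C] belongs to
   [F], that is, [P C]. *)
have := cC X F (fun i x => i <> x) FF.
have h x : C x -> \forall x' \near x & i \near F, i <> x'.
  move=> /loc[U nU PUx]; exists (U, ~` U) => /=.
    by split => //; change (P (~` ~` U)); rewrite setCK.
  by move=> [u v] /= [Uu nUv] vu; apply: nUv; rewrite vu.
move=> /(_ h); rewrite nearE /F /=; apply: PS => x Cx /=; by move/(_ x Cx).
Qed.

(** * Separation of disjoint compact sets *)

Section CompactSeparation.
Context {R : realType} {H : normedModType R} (ip : {dot H for idfun}).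
Hypothesis ip_norm : induces_norm ip.
Local Notation ec := (exp_closure R H ip).

Lemma ec_indic0 : ec (\1_set0).
Proof. by apply: ec_ext (ec_cst ip 0) => x; rewrite indic0. Qed.

(** Induction on the pieces of [C]: the sets separating [y] from two pieces are intersected, and the
    intersection is still a neighbourhood of [y]. *)
Lemma ec_separates_point_compact (C : set H) y : compact C -> ~ C y ->
  exists S : set H, [/\ ec (\1_S), nbhs y S & C `<=` ~` S].
Proof.
move=> cC nCy.
apply: (@compact_ind H (fun A => exists S : set H,
  [/\ ec (\1_S), nbhs y S & A `<=` ~` S])) => //.
- exists (~` set0); split; first by apply: ec_indicC; exact: ec_indic0.
    by rewrite setC0; exact: filterT.
  by [].
- move=> A B [S [eS yS AS]] [S' [eS' yS' BS']]; exists (S `&` S'); split.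
  + exact: ec_indicI.
  + exact: filterI.
  + by rewrite setCI; exact: setUSS.
- by move=> A B AB [S [eS yS BS]]; exists S; split => //; exact: subset_trans BS.
- move=> x Cx; have yx : y != x by apply/eqP => yx; apply: nCy; rewrite yx.
  have [S [eS yS xS]] := ec_separates_points ip ip_norm y x yx.
  by exists (~` S) => //; exists S; split.
Qed.

(** Induction on the pieces of [D], now with unions of sets that all avoid [C]. *)
Lemma ec_separates_compacts (C D : set H) : compact C -> compact D ->
  C `&` D = set0 -> exists S : set H, [/\ ec (\1_S), D `<=` S & C `<=` ~` S].
Proof.
move=> cC cD CD.
apply: (@compact_ind H (fun A => exists S : set H,
  [/\ ec (\1_S), A `<=` S & C `<=` ~` S])) => //.
- by exists set0; split=> //; [exact: ec_indic0|rewrite setC0].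
- move=> A B [S [eS AS CS]] [S' [eS' BS' CS']]; exists (S `|` S'); split.
  + exact: ec_indicU.
  + exact: setUSS.
  + by rewrite setCU subsetI.
- by move=> A B AB [S [eS BS CS]]; exists S; split => //; exact: subset_trans BS.
- move=> x Dx; have nCx : ~ C x by move=> Cx; have : set0 x by rewrite -CD.
  have [S [eS xS CS]] := ec_separates_point_compact C x cC nCx.
  by exists S => //; exists S; split.
Qed.

End CompactSeparation.

(** * Vanishing of a charge of zero potential *)

Section Vanishing.
Context {R : realType} {H : normedModType R} (ip : {dot H for idfun}).
Hypothesis ip_norm : induces_norm ip.
Variable sigma : R.
Hypothesis sigma_gt0 : 0 < sigma.
Variable nu : {charge set (borel H) -> \bar R}.
Local Notation ec := (exp_closure R H ip).
Local Notation bm := (bmeas _ (borel H) R).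

(** The factor depending on [x] alone in [gaussian_factor]; it turns exponentials into multiples of
    kernel functions. *)
Definition gauss_weight (x : H) : R := expR (- (sigma * `|x| ^+ 2)).
Local Notation h := gauss_weight.

Lemma gauss_weight_bmeas : bm h.
Proof.
have := gaussian_bmeas ip ip_norm _ sigma_gt0 0.
by rewrite /gaussian_kernel; under eq_fun do rewrite subr0.
Qed.

Lemma ec_measurable f : ec f -> measurable_fun (setT : set (borel H)) f.
Proof.
elim=> [w|a {}f g _ mf _ mg|F g C c _ mF _ Fg].
- apply: continuous_borel_measurable => x.
  apply: continuous_comp; last exact: continuous_expR.
  apply: (lipschitz_continuous _ _ (fun x => ip x w) `|w|) => u v.
  by rewrite -ipBl mulrC ip_CauchySchwarz.
- by apply: measurable_funD => //; apply: measurable_funM.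
- by apply: (@measurable_fun_cvg _ (borel H) R setT F g mF) => x _; exact: Fg.
Qed.

(** Completing the square: the exponent is largest at [r = c / (2 * sigma)]. *)
Lemma gauss_weight_growth (c r : R) :
  expR (- (sigma * r ^+ 2)) * expR (c * r) <= expR (c ^+ 2 / (4 * sigma)).
Proof.
rewrite -expRD ler_expR -subr_ge0.
have -> : c ^+ 2 / (4 * sigma) - (- (sigma * r ^+ 2) + c * r) =
   sigma * (r - c / (2 * sigma)) ^+ 2 by field; rewrite gt_eqF.
by rewrite mulr_ge0 ?sqr_ge0// ltW.
Qed.

Lemma gauss_weight_dominated f C c : (forall x, `|f x| <= C * expR (c * `|x|)) ->
  forall x, `|h x * f x| <= C * expR (c ^+ 2 / (4 * sigma)).
Proof.
move=> fC x; have C0 : 0 <= C.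
  by have := le_trans (normr_ge0 _) (fC x); rewrite pmulr_lge0// expR_gt0.
rewrite normrM ger0_norm ?expR_ge0//.
rewrite (le_trans (ler_wpM2l _ (fC x))) ?expR_ge0// mulrCA.
by rewrite ler_wpM2l// gauss_weight_growth.
Qed.

Lemma ec_bmeas f : ec f -> bm (fun x => h x * f x).
Proof.
move=> ef; split.
  by apply: measurable_funM; [case: gauss_weight_bmeas|exact: ec_measurable].
have [C [c fC]] := ec_growth ip ip_norm f ef.
by exists (C * expR (c ^+ 2 / (4 * sigma))); exact: gauss_weight_dominated.
Qed.

Hypothesis potential_nu0 : forall z, potential sigma nu z = 0.

Lemma ec_integral0 f : ec f -> charge_integral nu (fun x => h x * f x) = 0.
Proof.
elim=> [w|a {}f g ef f0 eg g0|F g C c eF F0 FC Fg].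
(* This [z] satisfies [2 * sigma * ip x z = ip x w], so the weighted exponential is a multiple of
   the kernel function at [z], whose integral is [potential sigma nu z]. *)
- pose z := (2 * sigma)^-1 *: w.
  have hE x : h x * expR (ip x w) = expR (sigma * `|z| ^+ 2) * gaussian_kernel sigma x z.
    have hz : expR (sigma * `|z| ^+ 2) * h z = 1 by rewrite /h -expRD subrr expR0.
    have zE : 2 * sigma * ip x z = ip x w.
      by rewrite /z ipZr mulVKf// mulf_neq0// gt_eqF.
    by rewrite (gaussian_factor ip ip_norm) zE -[LHS]mul1r -hz -/(h x) -/(h z); ring.
  under eq_fun do rewrite hE.
  rewrite charge_integralE sintZ; last exact: gaussian_bmeas.
  by have := potential_nu0 z; rewrite /potential charge_integralE => ->; rewrite mulr0.
- have -> : (fun x => h x * (a * f x + g x)) =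
      (fun x => a * (h x * f x) + h x * g x) by apply/funext => x; ring.
  rewrite charge_integralE sintD; [|exact/bmeasZ/ec_bmeas|exact: ec_bmeas].
  rewrite sintZ; last exact: ec_bmeas.
  by rewrite -!charge_integralE f0 g0 mulr0 addr0.
- have mF n : measurable_fun (setT : set (borel H)) (fun x => h x * F n x).
    by case: (ec_bmeas _ (eF n)).
  have pw x : h x * F n x @[n --> \oo] --> h x * g x.
    by apply: cvgM; [exact: cvg_cst|exact: Fg].
  have cv := sint_cvg _ _ _ (jordan_pos (hahn_pos_neg nu))
    (jordan_neg (hahn_pos_neg nu)) (fun n x => h x * F n x)
    (fun x => h x * g x) _ mF (fun n => gauss_weight_dominated _ _ _ (FC n))
    pw.
  have F0' n : sint _ _ _ (jordan_pos (hahn_pos_neg nu))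
      (jordan_neg (hahn_pos_neg nu)) (fun x => h x * F n x) = 0 by exact: F0.
  rewrite charge_integralE -(cvg_lim _ cv)//.
  by under eq_fun do rewrite F0'; exact: lim_cst.
Qed.

Hypothesis nu_reg : inner_regular H R nu.

Local Notation m1 := (jordan_pos (hahn_pos_neg nu)).
Local Notation m2 := (jordan_neg (hahn_pos_neg nu)).

Lemma gauss_weight_le1 x : h x <= 1.
Proof. by rewrite -expR0 ler_expR oppr_le0 mulr_ge0 ?(ltW sigma_gt0)// exprn_ge0. Qed.

(** Up to [e], [m1] lives on [K1] and [m2] on [K2], and [S] contains [K1] and misses [K2]. Since
    [h * \1_S] integrates to 0 against [nu], its integral against [m1] equals that against [m2],
    which only counts points outside [K2]. *)
Lemma gauss_weight_pos_small (e : R) : 0 < e -> \int[m1]_x h x <= 2 * e.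
Proof.
move=> e0; have [[mP _] [mN _] _ PN0] := hahn_pos_neg nu.
have [K1 [cK1 K1P nuK1]] := nu_reg _ _ mP e0.
have [K2 [cK2 K2N nuK2]] := nu_reg _ _ mN e0.
have K12 : K2 `&` K1 = set0.
  by apply/seteqP; split => // x [/K2N Nx /K1P Px]; rewrite -PN0.
have [S [eS K1S K2S]] := ec_separates_compacts ip ip_norm _ _ cK2 cK1 K12.
have hsf : hausdorff_space H by exact: norm_hausdorff.
have mK (K : set H) : compact K -> measurable (K : set (borel H)).
  move=> cK; rewrite -[K]setCK; apply: (@measurableC _ (borel H)).
  by apply: borel_open; rewrite openC; exact: compact_closed.
have mK1 := mK _ cK1; have mK2 := mK _ cK2.
(* [m1] is [nu] restricted to the positive Hahn set, so only the part of that set outside [K1]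
   counts. *)
have m1K1 : fine (m1 (~` K1)) <= e.
  rewrite jordan_posE cjordan_posE /crestr0 mem_set; last exact: measurableC.
  apply: le_trans (ler_norm _) (nuK1 _ _ _).
    by apply: measurableI => //; exact: measurableC.
  by move=> x [].
have m2K2 : fine (m2 (~` K2)) <= e.
  rewrite jordan_negE cjordan_negE /crestr0 mem_set; last exact: measurableC.
  rewrite fineN; apply: le_trans (ler_norm _) _; rewrite normrN; apply: nuK2.
    by apply: measurableI => //; exact: measurableC.
  by move=> x [].
have J0 := ec_integral0 _ eS; rewrite charge_integralE /sint in J0.
have I1 (A : set (borel H)) (m : {finite_measure set (borel H) -> \bar R}) :
    measurable A -> \int[m]_x (\1_A x) = fine (m A).
  by move=> mA; rewrite /Rintegral integral_indic// setIT.
have int_indic (A : set (borel H)) (m : {finite_measure set (borel H) -> \bar R}) :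
    measurable A -> m.-integrable setT (EFin \o (\1_A : _ -> R)).
  by move=> mA; exact/bmeas_integrable/bmeas_indic.
have low : \int[m1]_x h x <= \int[m1]_x (h x * \1_S x) + e.
  apply: (@le_trans _ _ (\int[m1]_x (h x * \1_S x + \1_(~` K1) x))).
    apply: le_Rintegral => //.
    - exact/bmeas_integrable/gauss_weight_bmeas.
    - apply: bmeas_integrable; apply: bmeasD; first exact: ec_bmeas.
      by apply: bmeas_indic; exact: measurableC.
    - move=> x _; have [K1x|nK1x] := pselect (K1 x).
        by rewrite (indicE _ S) mem_set ?mulr1 ?lerDl ?indicE ?ler0n//; exact: K1S.
      rewrite (indicE _ (~` _)) mem_set//= (le_trans (gauss_weight_le1 x))// lerDr.
      by rewrite mulr_ge0 ?expR_ge0// indicE.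
  rewrite RintegralD//; last 2 first.
  - exact/bmeas_integrable/ec_bmeas.
  - by apply: int_indic; exact: measurableC.
  by rewrite lerD2l I1//; exact: measurableC.
have up : \int[m2]_x (h x * \1_S x) <= e.
  apply: le_trans m2K2; rewrite -I1; last exact: measurableC.
  apply: le_Rintegral => //.
  - exact/bmeas_integrable/ec_bmeas.
  - by apply: int_indic; exact: measurableC.
  - move=> x _; have [Sx|nSx] := pselect (S x).
      rewrite (indicE _ (~` _)) mem_set/=; last by move=> /K2S.
      by rewrite (indicE _ S) mem_set//= mulr1 gauss_weight_le1.
    by rewrite (indicE _ S) memNset//= mulr0 indicE.
by rewrite (le_trans low)// mulr_natl mulr2n lerD2r (subr0_eq J0).
Qed.

Lemma gauss_weight_integral_eq0 (m : {finite_measure set (borel H) -> \bar R}) :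
  \int[m]_x h x = 0 -> forall A, measurable A -> m A = 0%E.
Proof.
move=> mh0.
have mh : measurable_fun (setT : set (borel H)) (EFin \o h).
  by apply/measurable_EFinP; case: gauss_weight_bmeas.
have : (\int[m]_x `|(EFin \o h) x|)%E = 0%E.
  under eq_integral do rewrite gee0_abs ?lee_fin ?expR_ge0//.
  rewrite -[LHS]fineK; first by rewrite -/(Rintegral m setT h) mh0.
  exact: (integrable_fin_num measurableT (bmeas_integrable _ _ _ m gauss_weight_bmeas)).
move=> /(ae_eq_integral_abs m measurableT mh)[N [mN N0 hN]].
(* The null set [N] contains every point where [h] is nonzero, and [h] is positive everywhere. *)
have NT : N = setT.
  apply/seteqP; split => // x _; apply: hN => /= /(_ I) /eqP.
  by rewrite eqe gt_eqF// expR_gt0.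
move=> A mA; apply/eqP; rewrite eq_le measure_ge0 andbT -N0 NT.
by apply: le_measure; rewrite ?inE.
Qed.

Lemma potential0_charge_eq0 (A : set (borel H)) : measurable A -> nu A = 0%E.
Proof.
have i1 : \int[m1]_x h x = 0.
  apply/eqP; rewrite eq_le Rintegral_ge0 ?andbT; last by move=> x _; exact: expR_ge0.
  apply/ler_addgt0Pl => e e0; rewrite addr0.
  by have := gauss_weight_pos_small (e / 2); rewrite divr_gt0// mulrC divfK//; exact.
(* The constant 1 lies in the closure, so [h] itself integrates to 0 against [nu]. *)
have i2 : \int[m2]_x h x = 0.
  have := ec_integral0 _ (ec_cst ip 1); under eq_fun do rewrite mulr1.
  by rewrite charge_integralE /sint i1 sub0r => /eqP; rewrite oppr_eq0 => /eqP.
move=> mA; rewrite jordan_decomp_sub//.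
rewrite (gauss_weight_integral_eq0 m1 i1 A mA) (gauss_weight_integral_eq0 m2 i2 A mA).
by rewrite sube0.
Qed.

End Vanishing.

(** * The complex kernel *)

Lemma dot_CauchySchwarz (C : numClosedFieldType) (U : lmodType C)
    (f : {dot U for Num.conj}) (u v : U) :
  `|f u v| ^+ 2 <= f u u * f v v.
Proof.
have [->|v0] := eqVneq v 0; first by rewrite linear0r normr0 expr0n mulr_ge0// dnorm_ge0.
have vv0 : 0 < f v v by rewrite dnorm_gt0.
have vvr : Num.conj (f v v) = f v v by rewrite geC0_conj// ltW.
set a := f u v; set N := f v v in vv0 vvr *; pose c := a / N.
have cE : Num.conj c = Num.conj a / N by rewrite /c rmorphM fmorphV /= vvr.
have ucE : f u (c *: v) = Num.conj c * a by rewrite linearZr_LR.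
have := dnorm_ge0 f (u - c *: v).
have dE : Num.conj (f u (c *: v)) = c * Num.conj a by rewrite ucE rmorphM /= conjCK.
rewrite dnormB dnormZ dE ucE !normCK cE -/N.
have -> : f u u + c * (Num.conj a / N) * N - (Num.conj a / N * a + c * Num.conj a) =
    (f u u * N - a * Num.conj a) / N by rewrite /c; field; rewrite gt_eqF.
by rewrite pmulr_lge0 ?invr_gt0// subr_ge0.
Qed.

Section ComplexGaussian.
Context {R : realType} {H : normedModType R} (ip : {dot H for idfun}).
Hypothesis ip_norm : induces_norm ip.
Variable sigma : R.
Hypothesis sigma_gt0 : 0 < sigma.
Local Notation G := (@gaussian_kernel R H sigma).
Local Notation Re := (@complex.Re R).
Local Notation Im := (@complex.Im R).

(** As [G] is real and symmetric, the imaginary part cancels on exchanging [i] and [j], and the real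
    part is the sum of the forms of [G] at the real and imaginary parts of [c]. *)
Lemma gaussian_positive_definite : positive_definite (complex_kernel G).
Proof.
move=> n x c _.
have ReS (f : 'I_n -> Cplx R) : Re (\sum_(i < n) f i) = \sum_(i < n) Re (f i).
  exact: (big_morph _ ReD erefl).
have ImS (f : 'I_n -> Cplx R) : Im (\sum_(i < n) f i) = \sum_(i < n) Im (f i).
  exact: (big_morph _ ImD erefl).
have ReE i j : Re (c i * Num.conj (c j) * complex_kernel G (x i) (x j)) =
    Re (c i) * Re (c j) * G (x i) (x j) + Im (c i) * Im (c j) * G (x i) (x j).
  by rewrite /complex_kernel; case: (c i) => a b; case: (c j) => a' b' /=; ring.
have ImE i j : Im (c i * Num.conj (c j) * complex_kernel G (x i) (x j)) =
    Im (c i) * Re (c j) * G (x i) (x j) - Re (c i) * Im (c j) * G (x i) (x j).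
  by rewrite /complex_kernel; case: (c i) => a b; case: (c j) => a' b' /=; ring.
rewrite lecE /= ReS ImS; apply/andP; split.
  apply/eqP; under eq_bigr do rewrite ImS.
  under eq_bigr do under eq_bigr do rewrite ImE.
  under eq_bigr do rewrite sumrB.
  rewrite sumrB [X in _ - X]exchange_big /=; apply/eqP; rewrite subr_eq0; apply/eqP.
  apply: eq_bigr => i _; apply: eq_bigr => j _.
  by rewrite [Re _ * _]mulrC gaussian_sym.
under eq_bigr do rewrite ReS.
under eq_bigr do under eq_bigr do rewrite ReE.
under eq_bigr do rewrite big_split /=.
rewrite big_split /= addr_ge0//.
  exact: (psd_gaussian ip ip_norm sigma sigma_gt0 _ x (fun i => Re (c i))).
exact: (psd_gaussian ip ip_norm sigma sigma_gt0 _ x (fun i => Im (c i))).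
Qed.

(** By the reproducing property, [ev v x - ev v y] is the inner product of [v] with [k x - k y],
    whose squared norm is [2 * (1 - G x y)]; every function of the space is therefore Lipschitz. *)
Lemma gaussian_rkhs_continuous :
  rkhs (complex_kernel G) `<=` [set F | continuous F].
Proof.
move=> F [V [f [ev [[_ _ [k [evk fk _]]] [v _ <-]]]]] x.
have kk y z : f (k y) (k z) = (G z y)%:C%C by rewrite fk evk.
set A := Re (f v v).
have vvA : f v v = A%:C%C.
  have := dnorm_ge0 f v; rewrite /A lecE; case: (f v v) => a b /= /andP[/eqP-> _] //.
have A0 : 0 <= A by have := dnorm_ge0 f v; rewrite vvA lecR.
have lip y : Cabs (ev v x - ev v y) <= Num.sqrt (2 * sigma * A) * `|x - y|.
  rewrite -(ler_pXn2r (_ : 0 < 2)%N) ?nnegrE ?mulr_ge0 ?sqrtr_ge0 ?Cabs_ge0//.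
  rewrite exprMn sqr_sqrtr ?mulr_ge0 ?(ltW sigma_gt0)//.
  have : `|f v (k x - k y)| ^+ 2 <= f v v * f (k x - k y) (k x - k y).
    exact: dot_CauchySchwarz.
  have -> : f (k x - k y) (k x - k y) = (2 * (1 - G x y))%:C%C.
    rewrite linearBl !linearBr /= !kk !gaussian_diag (gaussian_sym sigma y x).
    by apply/eqP; rewrite eq_complex /=; apply/andP; split; apply/eqP; ring.
  rewrite linearBr /= !fk normCabs vvA.
  have -> : (Cabs (ev v x - ev v y))%:C%C ^+ 2 =
      ((Cabs (ev v x - ev v y)) ^+ 2)%:C%C :> Cplx R.
    by rewrite rmorphXn.
  rewrite -rmorphM /= lecR => /le_trans; apply.
  have : 1 - sigma * `|x - y| ^+ 2 <= G x y by exact: expR_ge1Dx.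
  have -> : 2 * sigma * A * `|x - y| ^+ 2 = A * (2 * (sigma * `|x - y| ^+ 2)) by ring.
  by move=> h; rewrite ler_wpM2l//; lra.
set L := Num.sqrt _ in lip.
have L1 : 0 < L + 1 by rewrite ltr_wpDl// sqrtr_ge0.
apply/(@cvgrPdist_lt _ (Cplx R) _ (nbhs x) (nbhs_filter x)) => e e0.
(* A positive element of [Cplx R] is real, so the tolerance can be taken in [R]. *)
have [r r0 re] : exists2 r : R, 0 < r & e = r%:C%C.
  by move: e0; rewrite ltcE; case: e => a b /= /andP[/eqP-> ?]; exists a.
near=> y.
rewrite re normCabs ltcR (le_lt_trans (lip y))//.
rewrite (@le_lt_trans _ _ ((L + 1) * `|x - y|))//.
  by rewrite ler_wpM2r// lerDl.
rewrite -ltr_pdivlMl// mulrC; near: y.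
by apply: cvgr_dist_lt; [exact: cvg_id|rewrite divr_gt0].
Unshelve. all: by end_near. Qed.

Lemma gaussian_strict (lam : complex_measure (borel H) R) : finite_radon lam ->
  complex_integral (conj_measure lam)
    (fun y => complex_integral lam (fun x => complex_kernel G x y)) = 0 ->
  forall A : set (borel H), measurable A -> lam A = 0%E.
Proof.
move=> radon_lam int0 A mA.
have E0 := complex_integral_conj_double _ _ _ lam G
  (potential_bmeas ip ip_norm sigma sigma_gt0 _)
  (potential_bmeas ip ip_norm sigma sigma_gt0 _) int0.
have regre := inner_regular_re_part _ _ _ radon_lam.
have regim := inner_regular_im_part _ _ _ radon_lam.
have Ere := energy_ge0 ip ip_norm sigma sigma_gt0 _ regre.
have Eim := energy_ge0 ip ip_norm sigma sigma_gt0 _ regim.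
have Ere0 : energy sigma (re_part lam) = 0.
  by move: E0; rewrite /energy in Ere Eim *; lra.
have Eim0 : energy sigma (im_part lam) = 0.
  by move: E0; rewrite /energy in Ere Eim *; lra.
have := potential0_charge_eq0 ip ip_norm sigma sigma_gt0 _
  (energy_eq0 ip ip_norm sigma sigma_gt0 _ regre Ere0) regre A mA.
have := potential0_charge_eq0 ip ip_norm sigma sigma_gt0 _
  (energy_eq0 ip ip_norm sigma sigma_gt0 _ regim Eim0) regim A mA.
rewrite /= /re_part /im_part => -[im0] [re0].
have /fineK <- : lam A \is a fin_num by exact: fin_num_measure.
by congr EFin; move: re0 im0; case: (fine _) => a b /= -> ->.
Qed.

End ComplexGaussian.

Theorem theorem3p2 (R : realType) (H : completeNormedModType R)
    (ip : {dot H for idfun}) (ip_norm : induces_norm ip)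
    (sigma : R) (sigma_gt0 : 0 < sigma) :
  ispd (complex_kernel (@gaussian_kernel R H sigma)).
Proof.
split.
- exact: norm_hausdorff.
- exists 1 => x y; rewrite CabsE /= expr0n addr0 sqrtr_sqr.
  exact: gaussian_norm_le1.
- exact: gaussian_positive_definite ip ip_norm sigma sigma_gt0.
- exact: gaussian_rkhs_continuous.
- exact: gaussian_strict ip ip_norm sigma sigma_gt0.
Qed.
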